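(* With the notation of the context, suppose given a homogeneous Joyce structure on $M$, a cotangent bundle structure $M\subset T_B^*$ with Liouville form $\lambda$ and projection $\rho\colon M\to B$, and a $\mathbb{C}^*$-invariant Lagrangian submanifold $R\subset Z_\infty$, satisfying the transversality assumption $(\star)$. Put $Y=q_\infty^{-1}(R)$, let $f\colon Y\to B$ be the induced map, and let $j\colon F\hookrightarrow X$ be the inclusion of a fibre $F=f^{-1}(b)\subset Y\subset X$. Let $\tau$ be the $\tau$-function on $Y$ defined using the potential $\Theta_0^{\rm L}=-\lambda$ on $Z_0=M$. Then $$d\log(\tau|_F)=j^*(2i\Theta_I)-j^*q_1^*(\Theta_1),$$ so that $\log(\tau|_F)$ is the generating function for the symplectic map $q_1\circ j\colon F\to Z_1$ with respect to the symplectic potentials $j^*(2i\Theta_I)$ and $\Theta_1$, where $F$ carries the symplectic form $j^*(2i\Omega_I)$.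
   Context: Everything is holomorphic. A period structure on a complex manifold $M$ of dimension $n=2d$ is an atlas of distinguished charts whose transition functions are linear maps in $GL_n(\mathbb{Z})$; co-ordinates $(z_1,\dots,z_n)$ of a distinguished chart are called integral linear. They induce local co-ordinates $(z_i,\theta_j)$ on the total space $\pi\colon X=T_M\to M$ by writing tangent vectors as $\sum_i\theta_i\,\partial/\partial z_i$. A Joyce structure on $M$ consists of a period structure, a holomorphic symplectic form $\omega=\frac12\sum_{p,q}\omega_{pq}\,dz_p\wedge dz_q$, with $(\omega_{pq})$ a constant matrix in integral linear co-ordinates, whose inverse matrix $(\eta_{pq})$ has entries in $2\pi i\,\mathbb{Z}$, and a non-linear connection $h\colon\pi^*(T_M)\to T_X$ on $\pi$ of the following form. Set $v_i=v(\partial/\partial z_i)=\partial/\partial\theta_i$ (the vertical lift) and $$h_i=h\left(\frac{\partial}{\partial z_i}\right)=\frac{\partial}{\partial z_i}+\sum_{p,q}\eta_{pq}\frac{\partial^2W}{\partial\theta_i\partial\theta_p}\frac{\partial}{\partial\theta_q},$$ where $W=W(z,\theta)$ is a locally-defined function with $W(z,0)=0=\frac{\partial W}{\partial\theta_i}(z,0)$, satisfying $$\frac{\partial^2W}{\partial\theta_i\partial z_j}-\frac{\partial^2W}{\partial\theta_j\partial z_i}=\sum_{p,q}\eta_{pq}\frac{\partial^2W}{\partial\theta_i\partial\theta_p}\frac{\partial^2W}{\partial\theta_j\partial\theta_q},$$ together with the symmetries: the functions $\frac{\partial^2W}{\partial\theta_i\partial\theta_j}$ are invariant under $\theta\mapsto\theta+2\pi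 i k$ for $k\in\mathbb{Z}^n$; $W(\lambda z,\theta)=\lambda^{-1}W(z,\theta)$ for $\lambda\in\mathbb{C}^*$; and $W(z,-\theta)=-W(z,\theta)$. The connections $h_\epsilon=h+\epsilon^{-1}v$, for $\epsilon\in\mathbb{C}^*\cup\{\infty\}$, are then flat. The Euler vector field on $X$ is $E=\sum_i z_i\,\partial/\partial z_i$ (in the co-ordinates $(z_i,\theta_j)$); the same formula defines a vector field on $M$, also denoted $E$. The Joyce structure is homogeneous if these generate $\mathbb{C}^*$-actions on $X$ and $M$; these then induce a $\mathbb{C}^*$-action on the twistor fibre $Z_\infty$ below. There are closed 2-forms on $X$: $$\Omega_+=\tfrac12\sum\omega_{pq}\,dz_p\wedge dz_q,\qquad 2i\,\Omega_I=-\sum\omega_{pq}\,dz_p\wedge d\theta_q,$$ $$\Omega_-=\tfrac12\sum\omega_{pq}\,d\theta_p\wedge d\theta_q+\sum\frac{\partial^2W}{\partial\theta_p\partial\theta_q}\,d\theta_p\wedge dz_q+\sum\frac{\partial^2W}{\partial z_p\partial\theta_q}\,dz_p\wedge dz_q.$$ For $\epsilon\in\mathbb{C}^*\cup\{\infty\}$ the twistor fibre $Z_\epsilon$ is the space of leaves of the foliation $\mathrm{im}(h_\epsilon)\subset T_X$, with quotient map $q_\epsilon\colon X\to Z_\epsilon$; also $Z_0=M$ and $q_0=\pi$. These leaf spaces are treated as complex manifolds (equivalently, all objects on $Z_\epsilon$ may be viewed as objects on $X$ descending along the foliation). There are symplectic forms $\Omega_\epsilon$ on $Z_\epsilon$ with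 $q_\epsilon^*(\Omega_\epsilon)=\epsilon^{-2}\Omega_++2i\epsilon^{-1}\Omega_I+\Omega_-$ for $\epsilon\in\mathbb{C}^*$, $q_\infty^*(\Omega_\infty)=\Omega_-$, and $\Omega_0=\omega$, $q_0^*(\Omega_0)=\Omega_+$. Set $\Theta_I=i_E(\Omega_I)$, so $d\Theta_I=\Omega_I$. A cotangent bundle structure on $M$ is a complex manifold $B$ and an open embedding $M\subset T_B^*$ such that $\omega$ is the restriction of the canonical symplectic form on $T^*_B$; $\rho\colon M\to B$ is the induced projection and $\lambda$ is the restriction to $M$ of the Liouville 1-form. In co-ordinates $(s_i,t_i)$ on $M$ induced by co-ordinates $t_i$ on $B$, $\omega=\sum_i dt_i\wedge ds_i$ and $\lambda=\sum_i s_i\,dt_i$, so $d(-\lambda)=\omega$. It is assumed that $\mathcal{L}_E(\lambda)=2\lambda$. Given a Lagrangian submanifold $R\subset Z_\infty$, set $Y=q_\infty^{-1}(R)\subset X$ with inclusion $i\colon Y\hookrightarrow X$, and $f=\rho\circ\pi\circ i\colon Y\to B$. Transversality assumption $(\star)$: for each $b\in B$ the restriction of $q_1\colon X\to Z_1$ to $f^{-1}(b)\subset Y\subset X$ is étale (a local isomorphism). It is known that $2i\Omega_I$ then restricts to a symplectic form on each fibre of $f$. The $\tau$-function on $Y$: choose a locally-defined 1-form $\Theta_1$ on $Z_1$ with $d\Theta_1=\Omega_1$ and a 1-form $\Theta_0$ on $Z_0$ with $d\Theta_0=\Omega_0$, $\mathcal L_E(\Theta_0)=2\Theta_0$. Since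 $\Omega_\infty|_R=0$, the term $q_\infty^*(\Theta_\infty)$ of the general definition is dropped on $Y$, and $\tau$ is the locally-defined function on $Y$, unique up to multiplication by constants, satisfying $$d\log(\tau)=i^*\bigl(q_0^*(\Theta_0)+2i\Theta_I-q_1^*(\Theta_1)\bigr).$$ (In $2i\Theta_I$ and $2i\Omega_I$, $i=\sqrt{-1}$.) Generating function: if $\phi\colon(S,\Omega_S)\to(S',\Omega_{S'})$ satisfies $\phi^*\Omega_{S'}=\Omega_S$ and $\Theta,\Theta'$ are symplectic potentials for $\Omega_S,\Omega_{S'}$, the generating function of $\phi$ with respect to them is a locally-defined function $K$ with $dK=\Theta-\phi^*\Theta'$. *)

(* Defs.v *)
From HB Require Import structures.
From mathcomp Require Import all_boot all_order all_algebra.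
From mathcomp Require Import complex.
From mathcomp Require Import all_classical all_reals all_analysis.

Set Implicit Arguments.
Unset Strict Implicit.
Unset Printing Implicit Defensive.

Import numFieldNormedType.Exports.
Import Order.TTheory GRing.Theory Num.Theory.
Local Open Scope classical_set_scope.
Local Open Scope ring_scope.

(* R[i], packed so that it carries its topology and its normed-module
   structure over itself. *)
Definition Cx (R : realType) : numClosedFieldType := R[i].

Definition cexp (R : realType) (z : Cx R) : Cx R :=
  let: (a +i* b)%C := (z : R[i]) in ((expR a * cos b) +i* (expR a * sin b))%C.

Definition twopii (R : realType) : Cx R := 2%:R * 'i * ((pi : R)%:C)%C.

Section Holomorphic.
Variable R : realType.
Local Notation C := (Cx R).

Fixpoint cdiffn (m : nat) (W : normedModType C) (k : nat)
    (U : set 'rV[C]_m) (f : 'rV[C]_m -> W) : Prop :=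
  (forall x, U x -> differentiable f x) /\
  match k with
  | 0%N => True
  | k'.+1 => forall v : 'rV[C]_m, cdiffn k' U (fun x => 'D_v f x)
  end.

(* Complex differentiability at every point of an open set implies complex
   differentiability to all orders; the definition records the latter. *)
Definition holo_on (m : nat) (W : normedModType C)
    (U : set 'rV[C]_m) (f : 'rV[C]_m -> W) : Prop :=
  forall k, cdiffn k U f.

End Holomorphic.

Section Manifolds.
Variable R : realType.
Local Notation C := (Cx R).

(* [cfun] and [cinv] are only meaningful on [cdom] and on its image. *)
Record chart (T : topologicalType) (n : nat) := Chart {
  cdom : set T;
  cfun : T -> 'rV[C]_n;
  cinv : 'rV[C]_n -> T;
  cdom_open : open cdom;
  cimg_open : open (cfun @` cdom);
  cfunK : forall x, cdom x -> cinv (cfun x) = x;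
  cfun_cont : forall x, cdom x -> {for x, continuous cfun};
  cinv_cont : forall z, (cfun @` cdom) z -> {for z, continuous cinv} }.

Definition cimg (T : topologicalType) n (c : chart T n) : set 'rV[C]_n :=
  cfun c @` cdom c.

Record cmanifold (n : nat) := CManifold {
  carrier :> topologicalType;
  atlas : set (chart carrier n);
  cm_hausdorff : hausdorff_space carrier;
  cm_second_countable : @second_countable carrier;
  cm_cover : forall x : carrier, exists c, atlas c /\ cdom c x;
  cm_trans : forall c c', atlas c -> atlas c' ->
    holo_on (cfun c @` (cdom c `&` cdom c')) (cfun c' \o cinv c) }.

Definition chart_at n (M : cmanifold n) (x : M) : chart M n :=
  projT1 (cid (cm_cover x)).

(* The differential of [f] at [x], read in the charts [c] and [c']. *)
Definition dmap m n (M : cmanifold m) (N : cmanifold n)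
    (c : chart M m) (c' : chart N n) (f : M -> N) (x : M)
    (v : 'rV[C]_m) : 'rV[C]_n :=
  'D_v (fun z => cfun c' (f (cinv c z))) (cfun c x).

Definition dtrans n (M : cmanifold n) (c c' : chart M n) (x : M)
  (v : 'rV[C]_n) : 'rV[C]_n := dmap c c' idfun x v.

Definition holo_map_on m n (M : cmanifold m) (N : cmanifold n)
    (U : set M) (f : M -> N) : Prop :=
  (forall x, U x -> {for x, continuous f}) /\
  forall (c : chart M m) (c' : chart N n), atlas c -> atlas c' ->
    holo_on (cfun c @` (cdom c `&` U `&` f @^-1` cdom c'))
            (fun z => cfun c' (f (cinv c z))).

Definition holo_map m n (M : cmanifold m) (N : cmanifold n) (f : M -> N) :=
  holo_map_on setT f.

Definition holo_fun_on m (M : cmanifold m) (U : set M) (g : M -> C) : Prop :=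
  forall c : chart M m, atlas c ->
    holo_on (cfun c @` (cdom c `&` U)) (fun z => g (cinv c z)).

Definition immersion m n (M : cmanifold m) (N : cmanifold n) (f : M -> N) :=
  forall x (c : chart M m) (c' : chart N n), atlas c -> atlas c' ->
    cdom c x -> cdom c' (f x) -> injective (dmap c c' f x).

Definition submersion m n (M : cmanifold m) (N : cmanifold n) (f : M -> N) :=
  forall x (c : chart M m) (c' : chart N n), atlas c -> atlas c' ->
    cdom c x -> cdom c' (f x) ->
    forall w, exists v, dmap c c' f x v = w.

Definition embedding m n (M : cmanifold m) (N : cmanifold n) (f : M -> N) :=
  [/\ holo_map f, injective f, immersion f &
      forall U : set M, open U -> exists V : set N, open V /\ U = f @^-1` V].

Definition open_embedding n (M N : cmanifold n) (f : M -> N) :=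
  embedding f /\ open (range f).

(* [f] presents the subset [A] of [N] as an embedded submanifold. *)
Definition submanifold m n (M : cmanifold m) (N : cmanifold n)
    (f : M -> N) (A : set N) := embedding f /\ range f = A.

Definition etale n (M N : cmanifold n) (f : M -> N) : Prop :=
  holo_map f /\
  forall x, exists (U : set M) (V : set N) (g : N -> M),
    [/\ open U, U x, open V, f @` U = V &
        (forall y, U y -> g (f y) = y) /\ holo_map_on V g].

(* Differential forms and vector fields are given by their expressions in
   the charts: [a c x v] is the value at [x] on the tangent vector whose
   components in the chart [c] are [v].  It is meaningful for [c] in the atlas
   and [x] in the domain of [c]. *)
Definition form1 n (M : cmanifold n) := chart M n -> M -> 'rV[C]_n -> C.
Definition form2 n (M : cmanifold n) :=
  chart M n -> M -> 'rV[C]_n -> 'rV[C]_n -> C.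
Definition vfield n (M : cmanifold n) := chart M n -> M -> 'rV[C]_n.

Definition eq1 n (M : cmanifold n) (U : set M) (a b : form1 M) : Prop :=
  forall c x v, atlas c -> cdom c x -> U x -> a c x v = b c x v.
Definition eq2 n (M : cmanifold n) (U : set M) (a b : form2 M) : Prop :=
  forall c x u v, atlas c -> cdom c x -> U x -> a c x u v = b c x u v.

Definition scale1 n (M : cmanifold n) (k : C) (a : form1 M) : form1 M :=
  fun c x v => k * a c x v.
Definition add1 n (M : cmanifold n) (a b : form1 M) : form1 M :=
  fun c x v => a c x v + b c x v.
Definition sub1 n (M : cmanifold n) (a b : form1 M) : form1 M :=
  fun c x v => a c x v - b c x v.
Definition scale2 n (M : cmanifold n) (k : C) (a : form2 M) : form2 M :=
  fun c x u v => k * a c x u v.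
Definition add2 n (M : cmanifold n) (a b : form2 M) : form2 M :=
  fun c x u v => a c x u v + b c x u v.
Definition zero2 n (M : cmanifold n) : form2 M := fun _ _ _ _ => 0.

Definition is_form1 n (M : cmanifold n) (U : set M) (a : form1 M) : Prop :=
  [/\ forall c x, atlas c -> cdom c x -> U x ->
        forall (k : C) u v, a c x (k *: u + v) = k * a c x u + a c x v,
      forall c v, atlas c ->
        holo_on (cfun c @` (cdom c `&` U))
          (fun z => a c (cinv c z) v) &
      forall c c' x v, atlas c -> atlas c' -> cdom c x -> cdom c' x -> U x ->
        a c' x (dtrans c c' x v) = a c x v].

Definition is_form2 n (M : cmanifold n) (U : set M) (a : form2 M) : Prop :=
  [/\ forall c x, atlas c -> cdom c x -> U x ->
        forall (k : C) u v w,
          a c x (k *: u + v) w = k * a c x u w + a c x v w,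
      forall c x, atlas c -> cdom c x -> U x ->
        forall u v, a c x u v = - a c x v u,
      forall c u v, atlas c ->
        holo_on (cfun c @` (cdom c `&` U))
          (fun z => a c (cinv c z) u v) &
      forall c c' x u v, atlas c -> atlas c' -> cdom c x -> cdom c' x -> U x ->
        a c' x (dtrans c c' x u) (dtrans c c' x v) = a c x u v].

Definition d0 n (M : cmanifold n) (g : M -> C) : form1 M :=
  fun c x v => 'D_v (fun z => g (cinv c z)) (cfun c x).

(* d a (u, v) = u (a v) - v (a u) for vectors u, v that are constant in the
   chart. *)
Definition d1 n (M : cmanifold n) (a : form1 M) : form2 M :=
  fun c x u v =>
    'D_u (fun z => a c (cinv c z) v) (cfun c x) -
    'D_v (fun z => a c (cinv c z) u) (cfun c x).

Definition dlog n (M : cmanifold n) (g : M -> C) : form1 M :=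
  fun c x v => (g x)^-1 * d0 g c x v.

Definition closed2 n (M : cmanifold n) (U : set M) (a : form2 M) : Prop :=
  forall c x u v w, atlas c -> cdom c x -> U x ->
    'D_u (fun z => a c (cinv c z) v w) (cfun c x) +
    'D_v (fun z => a c (cinv c z) w u) (cfun c x) +
    'D_w (fun z => a c (cinv c z) u v) (cfun c x) = 0.

Definition symplectic n (M : cmanifold n) (a : form2 M) : Prop :=
  [/\ is_form2 setT a, closed2 setT a &
      forall c x u, atlas c -> cdom c x ->
        (forall v, a c x u v = 0) -> u = 0].

Definition interior1 n (M : cmanifold n) (E : vfield M) (a : form2 M) :
  form1 M := fun c x v => a c x (E c x) v.

(* For v constant in the chart, (L_E a)(v) = E (a v) - a [E, v], and
   [E, v] = - D_v E. *)
Definition lie1 n (M : cmanifold n) (E : vfield M) (a : form1 M) : form1 M :=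
  fun c x v =>
    'D_(E c x) (fun z => a c (cinv c z) v) (cfun c x) +
    a c x ('D_v (fun z => E c (cinv c z)) (cfun c x)).

(* The chart around [f x] is irrelevant when [a] is a form. *)
Definition pull1 m n (M : cmanifold m) (N : cmanifold n) (f : M -> N)
    (a : form1 N) : form1 M :=
  fun c x v =>
    let c' := chart_at (f x) in a c' (f x) (dmap c c' f x v).
Definition pull2 m n (M : cmanifold m) (N : cmanifold n) (f : M -> N)
    (a : form2 N) : form2 M :=
  fun c x u v =>
    let c' := chart_at (f x) in
    a c' (f x) (dmap c c' f x u) (dmap c c' f x v).

Definition potential n (M : cmanifold n) (U : set M) (Th : form1 M)
    (Om : form2 M) : Prop :=
  [/\ open U, is_form1 U Th & eq2 U (d1 Th) Om].

(* [K], defined on [W], is a generating function of [phi : S -> S'] with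
   respect to the symplectic potentials [Th] and [Th'], the latter being
   defined on [U']. *)
Definition generating_function m n (S : cmanifold m) (S' : cmanifold n)
    (phi : S -> S') (OmS : form2 S) (OmS' : form2 S')
    (W : set S) (Th : form1 S) (U' : set S') (Th' : form1 S')
    (K : S -> C) : Prop :=
  [/\ symplectic OmS /\ symplectic OmS',
      holo_map phi /\ eq2 setT (pull2 phi OmS') OmS,
      potential W Th OmS /\ potential U' Th' OmS',
      W `<=` phi @^-1` U' &
      holo_fun_on W K /\ eq1 W (d0 K) (sub1 Th (pull1 phi Th'))].

(* [D c x] is the set of component vectors, in the
   chart [c], of the tangent vectors at [x] that belong to it. *)
Definition distribution n (M : cmanifold n) :=
  chart M n -> M -> set 'rV[C]_n.

Definition integral_manifold p n (M : cmanifold n) (D : distribution M)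
    (L : cmanifold p) (iota : L -> M) : Prop :=
  [/\ holo_map iota, injective iota, immersion iota &
      forall y (a : chart L p) (c : chart M n), atlas a -> atlas c ->
        cdom a y -> cdom c (iota y) ->
        range (dmap a c iota y) = D c (iota y)].

(* Two points lie on the same leaf of the foliation by [p]-dimensional leaves
   tangent to [D] when some connected integral manifold contains both. *)
Definition same_leaf p n (M : cmanifold n) (D : distribution M) (x y : M) :=
  exists (L : cmanifold p) (iota : L -> M),
    [/\ connected [set: L], integral_manifold D iota,
        range iota x & range iota y].

(* The complex structure on the set of leaves is the one for which the
   quotient map is a submersion. *)
Definition leaf_space p n m (M : cmanifold n) (D : distribution M)
    (Z : cmanifold m) (q : M -> Z) : Prop :=
  [/\ holo_map q, submersion q, range q = setT &
      forall x y, q x = q y <-> same_leaf p D x y].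

Definition Cstar_action n (M : cmanifold n) (act : C -> M -> M) : Prop :=
  [/\ forall x, act 1 x = x,
      forall a b x, a != 0 -> b != 0 -> act (a * b) x = act a (act b x),
      forall p : C * M, p.1 != 0 ->
        {for p, continuous (fun p : C * M => act p.1 p.2)} &
      forall c c', atlas c -> atlas c' ->
        holo_on [set w : 'rV[C]_(1 + n) | [/\ lsubmx w 0 0 != 0,
                   cimg c (rsubmx w) &
                   cdom c' (act (lsubmx w 0 0) (cinv c (rsubmx w)))]]
          (fun w => cfun c' (act (lsubmx w 0 0) (cinv c (rsubmx w))))].

Definition generates n (M : cmanifold n) (E : vfield M) (act : C -> M -> M) :=
  Cstar_action act /\
  forall c x, atlas c -> cdom c x ->
    'D_1 (fun a : C => cfun c (act a x)) 1 = E c x.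

End Manifolds.

Section Bundles.
Variable R : realType.
Local Notation C := (Cx R).

(* [X], with its projection to [M], is the total space of the tangent bundle:
   its charts are the (z, theta), where z is a chart of [M] and theta are the
   components of tangent vectors in that chart.  [base] recovers the chart z
   from (z, theta). *)
Record tangent_bundle n (M : cmanifold R n) (X : cmanifold R (n + n))
    (proj : X -> M) (base : chart R X (n + n) -> chart R M n) : Prop := {
  tb_base : forall c, atlas c -> atlas (base c);
  tb_surj : forall c0, atlas c0 -> exists c, atlas c /\ base c = c0;
  tb_dom : forall c, atlas c -> cdom c = proj @^-1` cdom (base c);
  tb_img : forall c, atlas c -> cimg c = [set w | cimg (base c) (lsubmx w)];
  tb_proj : forall c x, atlas c -> cdom c x ->
    lsubmx (cfun c x) = cfun (base c) (proj x);
  tb_fibre : forall c c' x, atlas c -> atlas c' -> cdom c x -> cdom c' x ->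
    rsubmx (cfun c' x) = dtrans (base c) (base c') (proj x) (rsubmx (cfun c x))
}.

Definition pair_rV n (s v : 'rV[C]_n) : C := \sum_i s 0 i * v 0 i.

(* Same for the cotangent bundle, with charts (t, s) where a covector is
   written sum_i s_i dt_i. *)
Record cotangent_bundle d (B : cmanifold R d) (T : cmanifold R (d + d))
    (proj : T -> B) (base : chart R T (d + d) -> chart R B d) : Prop := {
  cb_base : forall c, atlas c -> atlas (base c);
  cb_surj : forall c0, atlas c0 -> exists c, atlas c /\ base c = c0;
  cb_dom : forall c, atlas c -> cdom c = proj @^-1` cdom (base c);
  cb_img : forall c, atlas c -> cimg c = [set w | cimg (base c) (lsubmx w)];
  cb_proj : forall c x, atlas c -> cdom c x ->
    lsubmx (cfun c x) = cfun (base c) (proj x);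
  cb_fibre : forall c c' x v, atlas c -> atlas c' -> cdom c x -> cdom c' x ->
    pair_rV (rsubmx (cfun c' x)) (dtrans (base c) (base c') (proj x) v) =
    pair_rV (rsubmx (cfun c x)) v
}.

Definition wedge (V : Type) (a b : V -> C) (u v : V) : C :=
  a u * b v - a v * b u.

(* The coordinate covectors on the first and last [n] coordinates: dz_p and
   dtheta_p on a tangent bundle, dt_p and ds_p on a cotangent bundle. *)
Definition dfst n (p : 'I_n) (v : 'rV[C]_(n + n)) : C := lsubmx v 0 p.
Definition dsnd n (p : 'I_n) (v : 'rV[C]_(n + n)) : C := rsubmx v 0 p.

Definition liouville d (T : cmanifold R (d + d)) : form1 T :=
  fun c x v => \sum_(p < d) rsubmx (cfun c x) 0 p * dfst p v.

Definition canonical_symplectic d (T : cmanifold R (d + d)) : form2 T :=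
  fun c x u v => \sum_(p < d) wedge (dfst p) (dsnd p) u v.

(* The integral linear charts are the charts of the atlas of [M]; their
   transition functions are locally constant in GL_n(Z). *)
Definition period_structure n (M : cmanifold R n) : Prop :=
  forall c c' (x : M), atlas c -> atlas c' -> cdom c x -> cdom c' x ->
    exists2 A : 'M[int]_n, A \in unitmx &
      \forall y \near x, cfun c' y = cfun c y *m map_mx intr A.

End Bundles.

Section Joyce.
Variable R : realType.
Local Notation C := (Cx R).

Definition ez n (p : 'I_n) : 'rV[C]_(n + n) := row_mx (delta_mx 0 p) 0.
Definition eth n (p : 'I_n) : 'rV[C]_(n + n) := row_mx 0 (delta_mx 0 p).

Definition pdz n (p : 'I_n) (g : 'rV[C]_(n + n) -> C) : 'rV[C]_(n + n) -> C :=
  fun w => 'D_(ez p) g w.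
Definition pdth n (p : 'I_n) (g : 'rV[C]_(n + n) -> C) :
    'rV[C]_(n + n) -> C := fun w => 'D_(eth p) g w.

Definition matrix_form n (M : cmanifold R n) (om : chart R M n -> 'M[C]_n) :
    form2 M :=
  fun c x u v => 2%:R^-1 *
    \sum_p \sum_q om c p q * wedge (fun t : 'rV[C]_n => t 0 p)
                                   (fun t : 'rV[C]_n => t 0 q) u v.

(* h_i + k v_i, at the point of co-ordinates w, with eta the inverse matrix of
   the symplectic form and g the function W. *)
Definition hvec n (eta : 'M[C]_n) (g : 'rV[C]_(n + n) -> C) (k : C)
    (w : 'rV[C]_(n + n)) (i : 'I_n) : 'rV[C]_(n + n) :=
  ez i + (\sum_p \sum_q (eta p q * pdth i (pdth p g) w) *: eth q) + k *: eth i.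

(* The horizontal lift of sum_i v_i d/dz_i by h + k v. *)
Definition hlift n (eta : 'M[C]_n) (g : 'rV[C]_(n + n) -> C) (k : C)
    (w : 'rV[C]_(n + n)) (v : 'rV[C]_n) : 'rV[C]_(n + n) :=
  \sum_i v 0 i *: hvec eta g k w i.

Record joyce_structure n (M : cmanifold R n) := JoyceStructure {
  jX : cmanifold R (n + n);
  jpi : jX -> M;
  jbase : chart R jX (n + n) -> chart R M n;
  jX_tangent : tangent_bundle jpi jbase;
  j_period : period_structure M;

  jom : chart R M n -> 'M[C]_n;
  jom_anti : forall c, atlas c -> (jom c)^T = - jom c;
  jom_symplectic : symplectic (matrix_form jom);
  jeta_integral : forall c p q, atlas c ->
    exists m : int, invmx (jom c) p q = twopii R * m%:~R;

  (* [jW c] is the function W in the co-ordinates (z, theta) of [c]; the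
     normalisation jW0, jWth0 determines it uniquely from the connection. *)
  jW : chart R jX (n + n) -> 'rV[C]_(n + n) -> C;
  jW_holo : forall c, atlas c -> holo_on (cimg c) (jW c);
  jW0 : forall c z, atlas c -> cimg (jbase c) z -> jW c (row_mx z 0) = 0;
  jWth0 : forall c z i, atlas c -> cimg (jbase c) z ->
    pdth i (jW c) (row_mx z 0) = 0;
  (* the horizontal lifts h(v) agree on overlaps of charts *)
  jh_global : forall c c' x v, atlas c -> atlas c' -> cdom c x -> cdom c' x ->
    hlift (invmx (jom (jbase c'))) (jW c') 0 (cfun c' x)
      (dtrans (jbase c) (jbase c') (jpi x) v) =
    dtrans c c' x (hlift (invmx (jom (jbase c))) (jW c) 0 (cfun c x) v);
  jW_plebanski : forall c w i j, atlas c -> cimg c w ->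
    pdth i (pdz j (jW c)) w - pdth j (pdz i (jW c)) w =
    \sum_p \sum_q invmx (jom (jbase c)) p q *
      pdth i (pdth p (jW c)) w * pdth j (pdth q (jW c)) w;
  jW_periodic : forall c w i j (k : 'rV[int]_n), atlas c -> cimg c w ->
    pdth i (pdth j (jW c)) (w + row_mx 0 (twopii R *: map_mx intr k)) =
    pdth i (pdth j (jW c)) w;
  (* [L] confines lambda to values reached from 1 within the chart: beyond
     these, the point of co-ordinates lambda z need not be obtained from the
     point of co-ordinates z by rescaling, because of monodromy. *)
  jW_homog : forall c z th (L : set C), atlas c ->
    connected L -> L 1 ->
    (forall a, L a -> a != 0 /\ cimg (jbase c) (a *: z)) ->
    forall a, L a -> jW c (row_mx (a *: z) th) = a^-1 * jW c (row_mx z th);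
  jW_odd : forall c z th, atlas c -> cimg (jbase c) z ->
    jW c (row_mx z (- th)) = - jW c (row_mx z th) }.

Arguments jX {n M} J : rename.
Arguments jpi {n M} J : rename.
Arguments jbase {n M} J : rename.
Arguments jom {n M} J : rename.
Arguments jW {n M} J : rename.

Section JoyceForms.
Variables (n : nat) (M : cmanifold R n) (J : joyce_structure M).
Local Notation X := (jX J).

(* im(h + k v); thus im(h_epsilon) for k = epsilon^-1, and k = 0 for
   epsilon = oo. *)
Definition h_dist (k : C) : distribution X :=
  fun c x =>
    range (hlift (invmx (jom J (jbase J c))) (jW J c) k (cfun c x)).

(* Z_epsilon, for k = epsilon^-1 *)
Definition twistor_fibre (k : C) (Z : cmanifold R n) (q : X -> Z) : Prop :=
  leaf_space n (h_dist k) q.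

Definition euler_M : vfield M := fun c x => cfun c x.
Definition euler_X : vfield X := fun c x => row_mx (lsubmx (cfun c x)) 0.

Definition Omega0 : form2 M := matrix_form (jom J).

Definition Omega_plus : form2 X := fun c x u v =>
  2%:R^-1 * \sum_p \sum_q jom J (jbase J c) p q * wedge (dfst p) (dfst q) u v.

Definition Omega_I : form2 X := fun c x u v =>
  (2%:R * 'i)^-1 *
  - \sum_p \sum_q jom J (jbase J c) p q * wedge (dfst p) (dsnd q) u v.

Definition Omega_minus : form2 X := fun c x u v =>
  2%:R^-1 * (\sum_p \sum_q
    jom J (jbase J c) p q * wedge (dsnd p) (dsnd q) u v) +
  (\sum_p \sum_q
    pdth p (pdth q (jW J c)) (cfun c x) * wedge (dsnd p) (dfst q) u v) +
  (\sum_p \sum_q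
    pdz p (pdth q (jW J c)) (cfun c x) * wedge (dfst p) (dfst q) u v).

Definition twoi_Omega_I : form2 X := scale2 (2%:R * 'i) Omega_I.
Definition Theta_I : form1 X := interior1 euler_X Omega_I.
Definition twoi_Theta_I : form1 X := scale1 (2%:R * 'i) Theta_I.

(* the pullback to X of the symplectic form of Z_epsilon, for k = epsilon^-1 *)
Definition Omega_eps (k : C) : form2 X :=
  add2 (scale2 (k ^+ 2) Omega_plus)
       (add2 (scale2 (2%:R * 'i * k) Omega_I) Omega_minus).

Definition homogeneous (actM : C -> M -> M) (actX : C -> X -> X) : Prop :=
  generates euler_M actM /\ generates euler_X actX.

End JoyceForms.

Arguments Omega_eps {n M} J.
Arguments Omega_minus {n M} J.
Arguments twoi_Omega_I {n M} J.
Arguments twoi_Theta_I {n M} J.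

Record cotangent_structure d (M : cmanifold R (d + d))
    (J : joyce_structure M) := CotangentStructure {
  cB : cmanifold R d;
  cT : cmanifold R (d + d);
  cproj : cT -> cB;
  cbase : chart R cT (d + d) -> chart R cB d;
  cT_cotangent : cotangent_bundle cproj cbase;
  cemb : M -> cT;
  cemb_open : open_embedding cemb;
  cemb_symplectic :
    eq2 setT (Omega0 J) (pull2 cemb (@canonical_symplectic R d cT)) }.

Arguments cB {d M J} CB : rename.
Arguments cT {d M J} CB : rename.
Arguments cproj {d M J} CB : rename.
Arguments cemb {d M J} CB : rename.

Section Cotangent.
Variables (d : nat) (M : cmanifold R (d + d)) (J : joyce_structure M).
Variable CB : cotangent_structure J.

Definition rho : M -> cB CB := cproj CB \o cemb CB.

Definition lambda : form1 M := pull1 (cemb CB) (@liouville R d (cT CB)).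

Definition Theta0L : form1 M := scale1 (-1) lambda.

End Cotangent.

Arguments lambda {d M J} CB.
Arguments Theta0L {d M J} CB.

(* [tau], defined on the open set [V] of [Y], is a tau-function with respect to
   the potentials [Th0] on Z_0 = M and [Th1] on the open set [U1] of Z_1. *)
Definition tau_function n m (M : cmanifold R n) (J : joyce_structure M)
    (Z1 : cmanifold R n) (q1 : jX J -> Z1)
    (Y : cmanifold R m) (i : Y -> jX J)
    (Th0 : form1 M) (U1 : set Z1) (Th1 : form1 Z1)
    (V : set Y) (tau : Y -> C) : Prop :=
  [/\ open V, V `<=` (q1 \o i) @^-1` U1,
      holo_fun_on V tau, (forall y, V y -> tau y != 0) &
      eq1 V (dlog tau)
        (pull1 i (sub1 (add1 (pull1 (jpi J) Th0) (twoi_Theta_I J))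
                       (pull1 q1 Th1)))].

End Joyce.

Arguments euler_M {R n} M.
Arguments jpi {R n M} J : rename.
Arguments jbase {R n M} J : rename.
Arguments jW {R n M} J : rename.
Arguments cB {R d M J} CB : rename.
Arguments cT {R d M J} CB : rename.
Arguments Omega_eps {R n M} J.
Arguments Omega_minus {R n M} J.
Arguments twoi_Omega_I {R n M} J.
Arguments twoi_Theta_I {R n M} J.
Arguments rho {R d M J} CB.
Arguments lambda {R d M J} CB.
Arguments Theta0L {R d M J} CB.
Arguments zero2 {R n} M.
Arguments Omega0 {R n M} J.
Arguments Omega_plus {R n M} J.
Arguments Omega_I {R n M} J.
Arguments Theta_I {R n M} J.
Arguments euler_X {R n M} J.
Arguments h_dist {R n M} J.
Arguments twistor_fibre {R n M} J k Z q.
Arguments homogeneous {R n M} J.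
Arguments tau_function {R n m M} J.

(* Main.v *)
From HB Require Import structures.
Require Import Defs.
From mathcomp Require Import all_boot all_order all_algebra.
From mathcomp Require Import complex.
From mathcomp Require Import all_classical all_reals all_analysis.
From mathcomp Require Import ring lra.

Set Implicit Arguments.
Unset Strict Implicit.
Unset Printing Implicit Defensive.

Import numFieldNormedType.Exports.
Import Order.TTheory GRing.Theory Num.Theory.
Local Open Scope classical_set_scope.
Local Open Scope ring_scope.

(** Write [j] for the inclusion of the fibre [F] in [X]. Everything follows from
    two vanishing statements on [F].

    - The map [cemb o pi o j] sends [F] to the single fibre over [b] of the
      cotangent bundle of [B], along which the base coordinates [t_p] are constant
      ([dfst_fibre]). Each term of the Liouville form and of the canonical
      symplectic form has a factor [dt_p], so [lambda] and [Omega_+ = pi^* omega]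
      restrict to zero on [F] ([liouville_fibre], [canonical_symplectic_fibre],
      [pull2_jpi_Omega0]).
    - The map [qoo o j] takes its values in the Lagrangian submanifold [range r],
      so [Omega_- = qoo^* Omegaoo] restricts to zero on [F] ([pull2_isotropic]).
      The point is that a holomorphic map whose values lie in an embedded
      submanifold has its differential in the tangent spaces of that submanifold
      ([differential_factor], [tangent_in_submanifold]).

    The first item removes the term in [Theta_0] from the equation defining [tau],
    and the formula for [dlog (tau o k)] is what remains after pulling back along
    [k]. For the generating function, both items together give
    [(q1 o j)^* Omega_1 = j^*(Omega_+ + 2i Omega_I + Omega_-) = j^*(2i Omega_I)],
    a nondegenerate form because [q1 o j] is etale ([etale_inverse]). In an
    integral linear chart [2i Theta_I] is [- omega(z, dtheta)], a form with
    exterior derivative [2i Omega_I] ([twoi_Theta_I_form1], [d1_twoi_Theta_I]);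
    since [d] commutes with pullback ([d1_pull1]), [j^*(2i Theta_I)] is a potential
    of [j^*(2i Omega_I)], which is therefore closed ([d1_closed]). Finally, if
    [cexp K = tau o k] then [dK = dlog (tau o k)] ([derive_cexp]).

    Commutation of [d] with pullback and closedness of exact forms both rest on
    the symmetry of second complex derivatives ([schwarz]). It is proved, like
    the differentiation of [cexp], by restriction to real lines
    ([is_derive_Re]). *)

(** * Differentials and germs of holomorphic functions *)

Section Differentials.
Variables (K : numFieldType) (V W : normedModType K).

Lemma diff_eps (f : V -> W) x (e : K) : differentiable f x -> 0 < e ->
  \forall h \near 0, `|f (x + h) - f x - 'd f x h| <= e * `|h|.
Proof.
move=> /diff_locallyP[_ /eqaddoP H] e0.
have := H e e0; apply: filter_app; near=> h => /=.
rewrite -![(_ + _ : _ -> _) _]/(_ + _) -![(- _ : _ -> _) _]/(- _) /cst /=.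
by rewrite opprD addrA [h + x]addrC.
Unshelve. all: by end_near. Qed.

Lemma differentiable_near (f g : V -> W) x :
  (\forall y \near x, f y = g y) -> differentiable f x -> differentiable g x.
Proof.
move=> fg df.
have fgx : f x = g x by exact: nbhs_singleton fg.
have fgs : \forall h \near 0, f (h + x) = g (h + x).
  by move: fg; rewrite (near_shift 0) /= => H; near=> h; near: h;
     move: H; apply: filterS => h /=; rewrite subr0.
have H : g \o shift x = cst (g x) + 'd f x +o_ 0 id.
  apply/eqaddoP => e e0; move/diff_locallyP : df => [_ /eqaddoP /(_ e e0)].
  apply: filter_app; near=> h => /=.
  rewrite -![(_ + _ : _ -> _) _]/(_ + _) -![(- _ : _ -> _) _]/(- _) /cst /=.
  by rewrite fgx (near fgs h).
have dg : 'd g x = 'd f x :> (V -> W) by apply: diff_unique H; exact: diff_continuous.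
by apply/diff_locallyP; rewrite dg; split; [exact: diff_continuous|].
Unshelve. all: by end_near. Qed.

Lemma derive_linear (f : V -> W) x (k : K) u v : differentiable f x ->
  'D_(k *: u + v) f x = k *: 'D_u f x + 'D_v f x.
Proof. by move=> df; rewrite !deriveE// linearP. Qed.

End Differentials.

Lemma derive_comp (K : numFieldType) (U V W : normedModType K)
    (f : U -> V) (g : V -> W) x v :
  differentiable f x -> differentiable g (f x) ->
  'D_v (g \o f) x = 'D_('D_v f x) g (f x).
Proof.
move=> df dg; rewrite (deriveE v (differentiable_comp df dg)) (diff_comp df dg).
by rewrite (deriveE v df) (deriveE _ dg).
Qed.

Section HolomorphicGerms.
Variable R : realType.
Local Notation C := (Cx R).
Variable m : nat.
Local Notation V := 'rV[C]_m.

Section Codomain.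
Variable W : normedModType C.
Implicit Types (f g : V -> W) (U : set V) (x v : V) (k : nat).

Lemma cdiffn_diff k U f x : cdiffn k U f -> U x -> differentiable f x.
Proof. by case: k => [|k] [H _]; exact: H. Qed.

Lemma cdiffnW k U f : cdiffn k.+1 U f -> cdiffn k U f.
Proof.
elim: k f => [|k IH] f [df H]; split=> // v.
exact/IH/H.
Qed.

(** The conditions in [cdiffn] are imposed point by point, so that they can be
    tested locally. *)
Lemma cdiffn_local k U f :
  (forall x, U x -> exists2 U', U' x & cdiffn k U' f) -> cdiffn k U f.
Proof.
elim: k f => [|k IH] f H.
  by split=> // x /H[U' U'x hU']; exact: cdiffn_diff hU' U'x.
split=> [x /H[U' U'x hU']|v]; first exact: cdiffn_diff hU' U'x.
apply: IH => x /H[U' U'x [_ H']]; exists U' => //; exact: H'.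
Qed.

Lemma cdiffn_eq k U f g : open U -> (forall x, U x -> f x = g x) ->
  cdiffn k U f -> cdiffn k U g.
Proof.
move=> oU; elim: k f g => [|k IH] f g fg H.
  split=> // x Ux; apply: (differentiable_near (f := f)); last exact: cdiffn_diff H Ux.
  by apply: filterS (open_nbhs_nbhs (conj oU Ux)); exact: fg.
have nfg x : U x -> \forall y \near x, f y = g y.
  by move=> Ux; apply: filterS (open_nbhs_nbhs (conj oU Ux)); exact: fg.
split=> [x Ux|v].
  by apply: (differentiable_near (f := f)); [exact: nfg|exact: cdiffn_diff H Ux].
apply: IH (proj2 H v) => x Ux.
exact/near_eq_derive/nfg.
Qed.

(** Germs compose and can be modified away from the base point without keeping
    track of domains. *)
Definition holo_at f x := exists2 U, open_nbhs x U & holo_on U f.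

Lemma holo_on_at U f : open U -> holo_on U f <-> forall x, U x -> holo_at f x.
Proof.
move=> oU; split=> [H x Ux|H k]; first by exists U.
by apply: cdiffn_local => x /H[U' [oU' U'x] H']; exists U'.
Qed.

Lemma holo_at_diff f x : holo_at f x -> differentiable f x.
Proof. by case=> U [_ Ux] /(_ 0%N) hU; exact: cdiffn_diff hU Ux. Qed.

Lemma holo_at_cont f x : holo_at f x -> {for x, continuous f}.
Proof. by move=> /holo_at_diff; exact: differentiable_continuous. Qed.

Lemma holo_at_near f x : holo_at f x -> \forall y \near x, holo_at f y.
Proof.
case=> U oU hU; apply: filterS (open_nbhs_nbhs oU) => y Uy.
by exists U => //; split=> //; case: oU.
Qed.

Lemma holo_at_derive f x v : holo_at f x -> holo_at ('D_v f) x.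
Proof. by case=> U oU hU; exists U => // k; case: (hU k.+1) => _; exact. Qed.

Lemma holo_at_eq f g x :
  (\forall y \near x, f y = g y) -> holo_at f x -> holo_at g x.
Proof.
rewrite -nbhs_nearE nbhsE => -[U [oU Ux] fg] [U' [oU' U'x] hf].
exists (U `&` U'); first by split; [exact: openI|].
move=> k; apply: (cdiffn_eq (f := f)); first exact: openI.
  by move=> y [Uy _]; exact: fg.
by apply: cdiffn_local => y [_ U'y]; exists U'.
Qed.

Lemma cdiffn_cst k U (a : W) : cdiffn k U (cst a).
Proof.
elim: k a => [|k IH] a; first by split=> // x _; exact: differentiable_cst.
split=> [x _|v]; first exact: differentiable_cst.
rewrite (_ : 'D_v (cst a) = cst 0) //.
by apply/funext => x; rewrite derive_cst.
Qed.

Lemma holo_at_cst (a : W) x : holo_at (cst a) x.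
Proof.
by exists setT; [split=> //; exact: openT|move=> k; exact: cdiffn_cst].
Qed.

Lemma cdiffn_add k U f g : open U -> cdiffn k U f -> cdiffn k U g ->
  cdiffn k U (fun x => f x + g x).
Proof.
move=> oU; elim: k f g => [|k IH] f g hf hg;
  have dfg x : U x -> differentiable (fun x => f x + g x) x by
    move=> Ux; apply: differentiableD;
    [exact: cdiffn_diff hf Ux|exact: cdiffn_diff hg Ux].
  by split.
split=> // v.
apply: (cdiffn_eq (f := fun x => 'D_v f x + 'D_v g x)) => //.
  move=> x Ux; rewrite -deriveD//; apply: diff_derivable.
    exact: cdiffn_diff hf _.
  exact: cdiffn_diff hg _.
by apply: IH; [case: hf => _|case: hg => _]; exact.
Qed.

Lemma holo_at_add f g x : holo_at f x -> holo_at g x ->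
  holo_at (fun y => f y + g y) x.
Proof.
move=> [U [oU Ux] hf] [U' [oU' U'x] hg]; exists (U `&` U').
  by split=> //; exact: openI.
move=> k; apply: cdiffn_add; first exact: openI.
  by apply: cdiffn_local => y [Uy _]; exists U.
by apply: cdiffn_local => y [_ U'y]; exists U'.
Qed.

Lemma cdiffn_sum k U (I : Type) (s : seq I) (F : I -> V -> W) : open U ->
  (forall i, cdiffn k U (F i)) -> cdiffn k U (fun y => \sum_(i <- s) F i y).
Proof.
move=> oU H; elim: s => [|i s IH].
  by under eq_fun do rewrite big_nil; exact: cdiffn_cst.
by under eq_fun do rewrite big_cons; exact: cdiffn_add.
Qed.

Lemma holo_at_sum (I : Type) (s : seq I) (F : I -> V -> W) x :
  (forall i, holo_at (F i) x) -> holo_at (fun y => \sum_(i <- s) F i y) x.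
Proof.
move=> H; elim: s => [|i s IH].
  by under eq_fun do rewrite big_nil; exact: holo_at_cst.
by under eq_fun do rewrite big_cons; exact: holo_at_add.
Qed.

End Codomain.

Implicit Types (f g : V -> C).

Lemma cdiffn_mul k U f g : open U -> cdiffn k U f -> cdiffn k U g ->
  cdiffn k U (fun x => f x * g x).
Proof.
move=> oU; elim: k f g => [|k IH] f g hf hg;
  have dfg x : U x -> differentiable (fun x => f x * g x) x by
    move=> Ux; apply: differentiableM;
    [exact: cdiffn_diff hf Ux|exact: cdiffn_diff hg Ux].
  by split.
split=> // v.
apply: (cdiffn_eq (f := fun x => f x * 'D_v g x + g x * 'D_v f x)) => //.
  move=> x Ux; rewrite [RHS](deriveM (f := f) (g := g))//; apply: diff_derivable.
    exact: cdiffn_diff hf _.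
  exact: cdiffn_diff hg _.
apply: cdiffn_add => //; apply: IH.
- exact: cdiffnW.
- by case: hg => _; exact.
- exact: cdiffnW.
- by case: hf => _; exact.
Qed.

Lemma holo_at_mul f g x : holo_at f x -> holo_at g x ->
  holo_at (fun y => f y * g y) x.
Proof.
move=> [U [oU Ux] hf] [U' [oU' U'x] hg]; exists (U `&` U').
  by split=> //; exact: openI.
move=> k; apply: cdiffn_mul; first exact: openI.
  by apply: cdiffn_local => y [Uy _]; exists U.
by apply: cdiffn_local => y [_ U'y]; exists U'.
Qed.

Lemma holo_at_scale (a : C) f x : holo_at f x -> holo_at (fun y => a * f y) x.
Proof. by move=> hf; apply: holo_at_mul => //; exact: holo_at_cst. Qed.

End HolomorphicGerms.

Section Coordinates.
Variable R : realType.
Local Notation C := (Cx R).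

Lemma derive_linear_comp (m : nat) (W W' : normedModType C)
    (L : {linear W -> W'}) (f : 'rV[C]_m -> W) x v :
  continuous L -> differentiable f x ->
  'D_v (fun y => L (f y)) x = L ('D_v f x).
Proof.
move=> cL df; have dL := linear_differentiable (f x) cL.
by rewrite [LHS](derive_comp v df dL) (deriveE _ dL) (diff_lin _ cL).
Qed.

Lemma cdiffn_linear_comp (m : nat) (W W' : normedModType C)
    (L : {linear W -> W'}) k U (f : 'rV[C]_m -> W) :
  continuous L -> open U -> cdiffn k U f -> cdiffn k U (fun y => L (f y)).
Proof.
move=> cL oU; elim: k f => [|k IH] f hf;
  have dLf x : U x -> differentiable (fun y => L (f y)) x by
    move=> Ux; apply: differentiable_comp;
    [exact: cdiffn_diff hf Ux|exact: linear_differentiable].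
  by split.
split=> // v; apply: (cdiffn_eq (f := fun y => L ('D_v f y))) => //.
  by move=> x Ux; rewrite derive_linear_comp//; exact: cdiffn_diff hf Ux.
by apply: IH; case: hf => _; exact.
Qed.

Lemma holo_at_linear_comp (m : nat) (W W' : normedModType C)
    (L : {linear W -> W'}) (f : 'rV[C]_m -> W) x :
  continuous L -> holo_at f x -> holo_at (fun y => L (f y)) x.
Proof.
move=> cL [U [oU Ux] hf]; exists U => // k; exact: cdiffn_linear_comp.
Qed.

Definition coord n (j : 'I_n) (w : 'rV[C]_n) : C := w 0 j.

Lemma coord_is_linear n (j : 'I_n) : linear (@coord n j).
Proof. by move=> k u v; rewrite /coord !mxE. Qed.

HB.instance Definition _ n (j : 'I_n) :=
  GRing.isLinear.Build C 'rV[C]_n C *:%R (@coord n j) (@coord_is_linear n j).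

Lemma coord_continuous n (j : 'I_n) : continuous (@coord n j).
Proof. by move=> w; apply: differentiable_continuous; exact: differentiable_coord. Qed.

Lemma derive_row n (W : normedModType C) (f : 'rV[C]_n -> W) x v :
  differentiable f x ->
  'D_v f x = \sum_j v 0 j *: 'D_(delta_mx 0 j) f x.
Proof.
move=> df; rewrite deriveE// [in LHS](row_sum_delta v) linear_sum.
by apply: eq_bigr => j _; rewrite linearZ /= deriveE.
Qed.

Lemma holo_at_coord (m n : nat) (f : 'rV[C]_m -> 'rV[C]_n) x j : holo_at f x ->
  holo_at (fun y => f y 0 j) x.
Proof. exact: holo_at_linear_comp (@coord_continuous n j). Qed.

Section Dimension.
Variables (m : nat).
Implicit Types (x v : 'rV[C]_m).

Lemma derive_coord n (f : 'rV[C]_m -> 'rV[C]_n) x v j : differentiable f x ->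
  'D_v (fun y => f y 0 j) x = ('D_v f x) 0 j.
Proof. by move=> df; rewrite (derive_linear_comp v (@coord_continuous n j) df). Qed.

Lemma holo_at_row n (f : 'rV[C]_m -> 'rV[C]_n) x :
  (forall j, holo_at (fun y => f y 0 j) x) -> holo_at f x.
Proof.
move=> H.
have -> : f = fun y => \sum_(j < n) f y 0 j *: delta_mx 0 j.
  by apply/funext => y; rewrite -row_sum_delta.
apply: holo_at_sum => j.
have lin : linear ( *:%R^~ (delta_mx 0 j) : C -> 'rV[C]_n).
  by move=> a b c; rewrite scalerDl scalerA.
pose LM := GRing.isLinear.Build _ _ _ _ _ lin.
pose L : {linear C -> 'rV[C]_n} := HB.pack ( *:%R^~ (delta_mx 0 j)) LM.
have cL : continuous L by exact: scalel_continuous.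
exact: (holo_at_linear_comp cL (H j)).
Qed.

(** By the chain rule the derivative of a composite is a sum of products of
    derivatives of [f] with partial derivatives of [g] composed with [f], to
    which the induction hypothesis on the order applies. *)
Lemma cdiffn_comp n k U U' (f : 'rV[C]_m -> 'rV[C]_n) (g : 'rV[C]_n -> C) :
  open U -> U `<=` f @^-1` U' ->
  cdiffn k U f -> cdiffn k U' g -> cdiffn k U (g \o f).
Proof.
move=> oU sU; elim: k g => [|k IH] g hf hg;
  have dgf x : U x -> differentiable (g \o f) x by
    move=> Ux; apply: differentiable_comp;
    [exact: cdiffn_diff hf Ux|exact: cdiffn_diff hg (sU _ Ux)].
  by split.
split=> // v.
apply: (cdiffn_eq
  (f := fun y => \sum_j ('D_v f y) 0 j * 'D_(delta_mx 0 j) g (f y))) => //.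
  move=> y Uy; have dg := cdiffn_diff hg (sU _ Uy).
  by rewrite (derive_comp v (cdiffn_diff hf Uy) dg) (derive_row _ dg).
apply: cdiffn_sum => // j; apply: cdiffn_mul => //.
  by apply: (cdiffn_linear_comp (@coord_continuous n j)) => //; case: hf => _; exact.
by apply: (IH ('D_(delta_mx 0 j) g)); [exact: cdiffnW|case: hg => _; exact].
Qed.

Lemma holo_at_comp_scalar n (f : 'rV[C]_m -> 'rV[C]_n) (g : 'rV[C]_n -> C) x :
  holo_at f x -> holo_at g (f x) -> holo_at (g \o f) x.
Proof.
move=> hf0 [U' [oU' U'x] hg]; have cf := holo_at_cont hf0.
case: hf0 => U [oU Ux] hf.
have : nbhs x (f @^-1` U') by apply: cf; exact: open_nbhs_nbhs.
rewrite nbhsE => -[A [oA Ax] sA].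
exists (U `&` A); first by split=> //; exact: openI.
move=> k; apply: (@cdiffn_comp _ _ _ U') => //; first exact: openI.
  by move=> y [_ /sA].
by apply: cdiffn_local => y [Uy _]; exists U.
Qed.

Lemma holo_at_comp n p (f : 'rV[C]_m -> 'rV[C]_n) (g : 'rV[C]_n -> 'rV[C]_p) x :
  holo_at f x -> holo_at g (f x) -> holo_at (g \o f) x.
Proof.
move=> hf hg; apply: holo_at_row => j.
by apply: (holo_at_comp_scalar (g := fun z => g z 0 j)) => //; exact: holo_at_coord.
Qed.

Lemma holo_at_id x : holo_at id x.
Proof.
exists setT; first by split=> //; exact: openT.
case=> [|k]; first by split.
split=> [y _ //|v].
rewrite (_ : 'D_v id = cst v); first exact: cdiffn_cst.
by apply/funext => y; rewrite derive_id.
Qed.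

End Dimension.
End Coordinates.

(** * Restriction to real lines and symmetry of second derivatives *)

Section RealRestriction.
Variable R : realType.
Local Notation C := (Cx R).
Local Notation Re := (@complex.Re R).
Local Notation toC t := ((t)%:C%C : C).

Lemma ltr0C (e : C) : 0 < e -> exists2 r : R, 0 < r & e = toC r.
Proof.
case: e => a b; rewrite ltcE /= => /andP[/eqP b0 a0].
by exists a; rewrite // b0.
Qed.

Lemma Re_le_norm (z : C) : `|Re z| <= complex.Re `|z|.
Proof. by have := normc_ge_Re z; rewrite lecE /= => /andP[]. Qed.

Lemma Re_continuous : continuous (Re : C -> R).
Proof.
move=> z; apply/(@cvgrPdist_lt _ _ _ (nbhs z)) => e e0.
have e0' : 0 < toC e by rewrite ltcR.
apply: filterS (nbhsx_ballx z _ e0') => y; rewrite -ball_normE /= ltcE => /andP[_] /=.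
apply: le_lt_trans; have := Re_le_norm (z - y).
by rewrite raddfB.
Qed.

Lemma realC_continuous : continuous (fun t : R => toC t).
Proof.
move=> t; apply/cvgrPdist_lt => e /ltr0C[r r0 ->].
apply: filterS (nbhsx_ballx t _ r0) => s; rewrite -ball_normE /= -rmorphB.
by rewrite normc_def /= expr0n addr0 sqrtr_sqr ltcR.
Qed.

(** The difference quotients of the real function are the real parts of those
    of [f] along the real axis of scalars; this is what makes one-variable real
    analysis available for complex derivatives. *)
Lemma is_derive_Re (V : normedModType C) (f : V -> C) a v (l : C) (t : R) :
  is_derive (a + toC t *: v) v f l ->
  is_derive t 1 (fun s : R => Re (f (a + toC s *: v))) (Re l).
Proof.
move=> [dl <-].
have H : (fun h : R => h^-1 *: (((fun s : R => Re (f (a + toC s *: v))) \o shift t) (h *: 1)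
   - Re (f (a + toC t *: v)))) @ 0^' --> Re ('D_v f (a + toC t *: v)).
  have H1 : (fun h : R => toC h) @ 0^' --> (0 : C)^'.
    move=> A /= [e e0 HA]; have [r r0 er] := ltr0C e0.
    exists r => // h hr h0; apply: HA; last first.
      by rewrite /= -[0]/(toC 0) (inj_eq (@complexI R)).
    move: hr; rewrite /= er /ball /= sub0r normrN -[0]/(toC 0) -rmorphB sub0r.
    by rewrite normc_def /= expr0n addr0 sqrtr_sqr ltcR normrN.
  have H2 := cvg_comp _ _ H1 dl.
  have H3 := cvg_comp _ _ H2 (@Re_continuous _).
  apply: cvg_trans H3; apply: near_eq_cvg; near=> h => /=.
  have -> : (toC h)^-1 = toC h^-1 by rewrite -fmorphV.
  have -> : toC h *: v + (a + toC t *: v) = a + toC (h *: 1 + t) *: v.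
    by rewrite [h *: 1]mulr1 rmorphD scalerDl addrCA.
  rewrite -raddfB.
  by case: (f _ - f _) => x y /=; rewrite mul0r subr0.
by split; [apply/cvg_ex; eexists; exact: H|exact: cvg_lim H].
Unshelve. all: by end_near. Qed.

Local Notation Im := (@complex.Im R).

Lemma is_derive_Im (V : normedModType C) (f : V -> C) a v (l : C) (t : R) :
  is_derive (a + toC t *: v) v f l ->
  is_derive t 1 (fun s : R => Im (f (a + toC s *: v))) (Im l).
Proof.
move=> dl; have ImRe (z : C) : Im z = Re ((- 'i%C : C) *: z).
  by case: z => x y; rewrite /= /GRing.scale /=; simpc.
under eq_fun do rewrite ImRe.
rewrite ImRe.
exact: (is_derive_Re (is_deriveZ (- 'i%C : C) dl)).
Qed.

Lemma derive_polar (a b : R -> R) (t a' b' : R) :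
  is_derive t 1 a a' -> is_derive t 1 b b' ->
  'D_1 (fun s => expR (a s) * cos (b s)) t =
    expR (a t) * cos (b t) * a' - expR (a t) * sin (b t) * b' /\
  'D_1 (fun s => expR (a s) * sin (b s)) t =
    expR (a t) * sin (b t) * a' + expR (a t) * cos (b t) * b'.
Proof.
move=> Da Db.
have Ee := @is_derive1_comp _ _ _ _ _ _ (is_derive_expR (a t)) Da.
have Ec := @is_derive1_comp _ _ _ _ _ _ (is_derive_cos (b t)) Db.
have Es := @is_derive1_comp _ _ _ _ _ _ (is_derive_sin (b t)) Db.
split.
  have E := is_deriveM Ee Ec.
  rewrite [LHS](@derive_val _ _ _ _ _ _ _ E) /GRing.scale /=; ring.
have E := is_deriveM Ee Es.
rewrite [LHS](@derive_val _ _ _ _ _ _ _ E) /GRing.scale /=; ring.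
Qed.

(** Along the real line through [x] in the direction [v], real and imaginary
    parts of [g] are [exp a * cos b] and [exp a * sin b], with [a] and [b] those
    of [k], and the product rule of real analysis applies. *)
Lemma derive_cexp (V : normedModType C) (k g : V -> C) x v :
  (\forall y \near x, cexp (k y) = g y) ->
  differentiable k x -> differentiable g x ->
  'D_v g x = g x * 'D_v k x.
Proof.
move=> kg dk dg.
have x0 : x + toC 0 *: v = x by rewrite scale0r addr0.
have Dk : is_derive (x + toC 0 *: v) v k ('D_v k x).
  by rewrite x0; apply: DeriveDef => //; exact: diff_derivable.
have Dg : is_derive (x + toC 0 *: v) v g ('D_v g x).
  by rewrite x0; apply: DeriveDef => //; exact: diff_derivable.
have Da := is_derive_Re Dk; have Db := is_derive_Im Dk.
have nkg : \forall t \near (0 : R), cexp (k (x + toC t *: v)) = g (x + toC t *: v).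
  have cv : (fun t : R => x + toC t *: v) @ (0 : R) --> x.
    rewrite -[X in _ --> X]x0; apply: cvgD; first exact: cvg_cst.
    by apply: cvgZr_tmp; exact: realC_continuous.
  exact: (cv _ kg).
set a := (fun s : R => Re _) in Da; set b := (fun s : R => Im _) in Db.
have ea (t : R) : cexp (k (x + toC t *: v)) =
    ((expR (a t) * cos (b t)) +i* (expR (a t) * sin (b t)))%C.
  by rewrite /cexp /a /b; case: (k _).
have DRe := is_derive_Re Dg; have DIm := is_derive_Im Dg.
have [P1 P2] := derive_polar Da Db.
have Q1 : Re ('D_v g x) = 'D_1 (fun t => expR (a t) * cos (b t)) (0 : R).
  rewrite -(@derive_val _ _ _ _ _ _ _ DRe); apply: near_eq_derive.
  by apply: filterS nkg => t /= <-; rewrite ea.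
have Q2 : Im ('D_v g x) = 'D_1 (fun t => expR (a t) * sin (b t)) (0 : R).
  rewrite -(@derive_val _ _ _ _ _ _ _ DIm); apply: near_eq_derive.
  by apply: filterS nkg => t /= <-; rewrite ea.
have gx : g x = ((expR (a 0) * cos (b 0)) +i* (expR (a 0) * sin (b 0)))%C.
  by rewrite -ea -[in LHS]x0 (nbhs_singleton nkg).
move: Q1 Q2; rewrite P1 P2 gx /=.
case: ('D_v g x) => u1 u2; case: ('D_v k x) => w1 w2 /= -> ->.
rewrite [RHS]/GRing.mul /=.
by congr (Complex _ _); ring.
Qed.

(** The real mean value theorem is applied to the real part of [f] multiplied by
    the conjugate of its total increment. *)
Lemma mean_value_le (V : normedModType C) (f : V -> C) a v :
  (forall t : R, 0 <= t <= 1 -> derivable f (a + toC t *: v) v) ->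
  exists2 c : R, 0 < c < 1 & `|f (a + v) - f a| <= `|'D_v f (a + toC c *: v)|.
Proof.
move=> df; set w := f (a + v) - f a.
(* [e * w] is the square of the modulus of [w], a real number *)
pose e : C := (w^*)%R.
pose psi := fun t : R => Re (e *: f (a + toC t *: v)).
have Dpsi (t : R) : 0 <= t <= 1 -> is_derive t 1 psi (Re (e *: 'D_v f (a + toC t *: v))).
  move=> t01; have dt := derivableP (df t t01).
  exact: (is_derive_Re (is_deriveZ e dt)).
have [t|t|c c01 E] := @MVT R psi (fun t => Re (e *: 'D_v f (a + toC t *: v))) 0 1 ltr01.
- by rewrite in_itv /= => /andP[t0 t1]; apply: Dpsi; rewrite !ltW.
- apply: derivable_within_continuous => {}t; rewrite in_itv /= => t01.
  exact: (@ex_derive _ _ _ _ _ _ _ (Dpsi t t01)).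
move: c01; rewrite in_itv /= => c01; exists c => //.
have ReB (z z' : C) : Re z - Re z' = Re (z - z') by case: z z' => ? ? [].
move: E; rewrite subr0 mulr1 /psi ReB -scalerBr !scale0r addr0 scale1r -/w => E.
have [w0|w0] := eqVneq w 0; first by rewrite w0 normr0.
have wgt : 0 < `|w| by rewrite normr_gt0.
rewrite -(ler_pM2l wgt) -expr2 normCK.
have -> : w * w^* = toC (Re (e *: w)).
  rewrite /GRing.scale /= /e mulrC.
  have := mul_conjC_ge0 w; rewrite mulrC; case: (_ * _) => p q.
  by rewrite lecE /= => /andP[/eqP -> _].
rewrite E -[X in _ <= X * _](norm_conjC w) -normrM.
apply: le_trans (normc_ge_Re _); rewrite lecR; exact: ler_norm.
Qed.

End RealRestriction.

Section MixedDerivatives.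
Variable R : realType.
Local Notation C := (Cx R).
Local Notation toC t := ((t)%:C%C : C).
Variable V : normedModType C.
Implicit Types (f : V -> C) (x u v w : V).

Lemma is_derive_line f b w (s : C) : differentiable f (b + s *: w) ->
  is_derive s 1 (fun z : C => f (b + z *: w)) ('D_w f (b + s *: w)).
Proof.
move=> /diff_derivable df.
have -> : (fun z : C => f (b + z *: w)) = fun z => (f \o shift (b + s *: w)) ((z - s) *: w).
  by apply/funext => z /=; rewrite scalerBl addrCA subrK.
have E : (fun h : C => h^-1 *: (((fun z => (f \o shift (b + s *: w)) ((z - s) *: w)) \o
    shift s) (h *: 1) - (fun z => (f \o shift (b + s *: w)) ((z - s) *: w)) s)) =
  (fun h => h^-1 *: ((f \o shift (b + s *: w)) (h *: w) - f (b + s *: w))).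
  by apply/funext => h /=; rewrite [h *: 1]mulr1 addrK subrr scale0r add0r.
by split; [rewrite /derivable E; exact: df|rewrite /derive E].
Qed.

Lemma derive_scale f x u (h : C) : differentiable f x ->
  'D_(h *: u) f x = h * 'D_u f x.
Proof. by move=> df; rewrite -[h *: u]addr0 derive_linear// derive0 addr0. Qed.

Lemma is_derive_mulr_cst (k s : C) : is_derive s 1 (fun z : C => z * k) k.
Proof.
have D := is_deriveM (is_derive_id s (1 : C)) (is_derive_cst (k : C) s (1 : C)).
by apply: is_derive_eq D _; rewrite scaler0 add0r; exact: mulr1.
Qed.

(** Mean value inequality for the increment of [f] along [h *: v], corrected by a
    linear term: its derivative along [h *: u] is estimated by the
    differentiability of ['D_u f] at [x]. *)
Lemma second_difference f x u v (e : C) :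
  (\forall y \near x, differentiable f y) -> differentiable ('D_u f) x ->
  0 < e -> \forall h \near (0 : C),
  `|f (x + h *: u + h *: v) - f (x + h *: u) - f (x + h *: v) + f x
     - h ^+ 2 * 'D_v ('D_u f) x| <= e * (`|u| + `|v| + `|u|) * `|h| ^+ 2.
Proof.
move=> df dDf e0.
have : \forall k \near (0 : V), differentiable f (x + k) /\
    `|'D_u f (x + k) - 'D_u f x - 'd ('D_u f) x k| <= e * `|k|.
  have H := diff_eps dDf e0.
  move: df; rewrite (near_shift (0 : V)) /= subr0 => df'.
  near=> k; split; last by near: k.
  by rewrite addrC; near: k.
case/nbhs_normP => r /= r0 Hr.
pose M := `|u| + `|v| + `|u| + 1.
have M0 : 0 < M by rewrite ltr_wpDl// !addr_ge0.
near=> h.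
have hM : `|h| * M < r.
  rewrite -ltr_pdivlMr//; near: h.
  by apply: filterS (nbhsx_ballx (0 : C) _ (divr_gt0 r0 M0)) => h;
    rewrite -ball_normE /= sub0r normrN.
pose D := 'D_v ('D_u f) x.
pose G := fun s : C =>
  f (x + h *: v + s *: (h *: u)) - f (x + s *: (h *: u)) - s * (h ^+ 2 * D).
have bnd (t : R) : 0 <= t <= 1 ->
    `|toC t *: (h *: u)| <= `|h| * `|u| /\
    `|h *: v + toC t *: (h *: u)| <= `|h| * (`|u| + `|v|).
  move=> /andP[t0 t1].
  have H : `|toC t *: (h *: u)| <= `|h| * `|u|.
    rewrite !normrZ ler_piMl ?mulr_ge0//.
    by rewrite ger0_norm ?ler0c// -[1]/(toC 1) lecR.
  split=> //; apply: le_trans (ler_normD _ _) _.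
  by rewrite mulrDr addrC lerD// normrZ.
have inball (k : V) c : `|k| <= `|h| * c -> c <= M -> ball_ Num.norm 0 r k.
  move=> kc cM; rewrite /ball_ /= sub0r normrN; apply: le_lt_trans hM.
  by apply: le_trans kc _; exact: ler_wpM2l.
have M1 : `|u| <= M by rewrite /M -!addrA lerDl !addr_ge0.
have M2 : `|u| + `|v| <= M by rewrite /M -!addrA lerD2l lerDl !addr_ge0.
have factor (p q k : C) : h * p - h * q - h ^+ 2 * k = h * (p - q - h * k).
  by rewrite expr2; ring.
have DG (t : R) : 0 <= t <= 1 -> is_derive (toC t) 1 G
   (h * ('D_u f (x + h *: v + toC t *: (h *: u)) - 'D_u f (x + toC t *: (h *: u)) - h * D)).
  move=> /bnd[b1 b2].
  have [d1 _] := Hr _ (inball _ _ b1 M1).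
  have [d2 _] := Hr _ (inball _ _ b2 M2).
  rewrite addrA in d2.
  have D1 := is_derive_eq (is_derive_line d1) (derive_scale u h d1).
  have D2 := is_derive_eq (is_derive_line d2) (derive_scale u h d2).
  have D3 := is_derive_mulr_cst (h ^+ 2 * D) (toC t).
  apply: is_derive_eq (is_deriveB (is_deriveB D2 D1) D3) _.
  exact: factor.
have dG (t : R) : 0 <= t <= 1 -> derivable G (0 + toC t *: 1) 1.
  by move=> t01; rewrite add0r [_ *: 1]mulr1; exact: (@ex_derive _ _ _ _ _ _ _ (DG t t01)).
have [t /andP[t0 t1]] := mean_value_le dG.
have t01 : 0 <= t <= 1 by rewrite !ltW.
rewrite !add0r [_ *: 1]mulr1 (@derive_val _ _ _ _ _ _ _ (DG t t01)).
rewrite {1 2}/G !scale1r !scale0r !addr0 mul1r mul0r subr0 -/D.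
have -> : x + h *: v + h *: u = x + h *: u + h *: v by rewrite addrAC.
set A := f _; set B := f _; set B' := f _ => HG.
have -> : A - B - B' + f x - h ^+ 2 * D = A - B - h ^+ 2 * D - (B' - f x) by ring.
apply: le_trans HG _.
rewrite normrM expr2 mulrCA -mulrA; apply: ler_wpM2l => //.
have [b1 b2] := bnd _ t01.
have [_ e1] := Hr _ (inball _ _ b1 M1).
have [_ e2] := Hr _ (inball _ _ b2 M2).
rewrite addrA in e2.
set L := 'd ('D_u f) x in e1 e2.
set p := 'D_u f _; set q := 'D_u f _.
have -> : p - q - h * D =
    (p - 'D_u f x - L (h *: v + toC t *: (h *: u))) - (q - 'D_u f x - L (toC t *: (h *: u))).
  rewrite linearD /= [L (h *: v)]linearZ /= /D (deriveE v dDf) -/L /GRing.scale /=; ring.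
apply: le_trans (ler_normB _ _) _.
apply: le_trans (lerD e2 e1) _.
rewrite -mulrDr; apply: ler_wpM2l; first exact: ltW.
apply: le_trans (lerD b2 b1) _.
by rewrite -mulrDr mulrC.
Unshelve. all: by end_near. Qed.

(** The second difference of [f] is symmetric in [u] and [v], and both mixed
    derivatives are its quotient by [h ^+ 2] up to an arbitrarily small error. *)
Lemma schwarz f x u v :
  (\forall y \near x, differentiable f y) ->
  differentiable ('D_u f) x -> differentiable ('D_v f) x ->
  'D_v ('D_u f) x = 'D_u ('D_v f) x.
Proof.
move=> df du dv; apply/eqP; rewrite -subr_eq0; apply/negP => /negP D0.
set D := _ - _ in D0.
pose M := (`|u| + `|v| + `|u|) + (`|v| + `|u| + `|v|).
have M0 : 0 <= M by rewrite !addr_ge0.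
pose e := `|D| / (M + 1).
have e0 : 0 < e by rewrite divr_gt0 ?normr_gt0// ltr_wpDl.
(* [H1] and [H2] bound the same second difference *)
have H1 := second_difference v df du e0.
have H2 := second_difference u df dv e0.
have gen (A B X Y k p q : C) : B = A ->
    `|A - k * X| <= p -> `|B - k * Y| <= q -> `|(X - Y) * k| <= p + q.
  move=> -> H H'; apply: le_trans (lerD H H'); apply: le_trans (ler_normB _ _).
  have -> : A - k * X - (A - k * Y) = - ((X - Y) * k) by ring.
  by rewrite normrN.
have : \forall h \near (0 : C)^', `|D| <= e * M.
  have dn (P : set C) : (\forall h \near (0 : C), P h) -> \forall h \near (0 : C)^', P h.
    exact: cvg_within.
  have {}H1 := dn _ H1; have {}H2 := dn _ H2.
  near=> h.
  have h0 : h != 0 by near: h; exact: nbhs_dnbhs_neq.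
  have E1 := near H1 h; have E2 := near H2 h.
  have h20 : 0 < `|h| ^+ 2 by rewrite exprn_gt0// normr_gt0.
  rewrite -(ler_pM2r h20) /M mulrDr mulrDl -normrX -normrM.
  rewrite normrX; apply: gen (E1 _) (E2 _) => //.
  by rewrite [x + h *: v + h *: u]addrAC -!addrA; congr (_ + _); rewrite addrCA.
move=> /filter_ex[_]; rewrite /e mulrAC ler_pdivlMr ?ltr_wpDl//.
by rewrite ler_pM2l ?normr_gt0// -subr_ge0 opprD addrA subrr add0r oppr_ge0 ler10.
Unshelve. all: by end_near. Qed.

End MixedDerivatives.

Section Charts.
Variable R : realType.
Local Notation C := (Cx R).

Lemma holo_schwarz m (f : 'rV[C]_m -> C) x u v : holo_at f x ->
  'D_u ('D_v f) x = 'D_v ('D_u f) x.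
Proof.
move=> hf; apply: schwarz.
- by apply: filterS (holo_at_near hf) => y; exact: holo_at_diff.
- exact/holo_at_diff/holo_at_derive.
- exact/holo_at_diff/holo_at_derive.
Qed.

(** * Charts, local expressions of maps and their differentials *)

Section OneChart.
Variables (T : topologicalType) (n : nat) (c : chart R T n).

Lemma cimg_dom z : cimg c z -> cdom c (cinv c z) /\ cfun c (cinv c z) = z.
Proof. by case=> x cx <-; rewrite cfunK. Qed.

Lemma dom_cimg x : cdom c x -> cimg c (cfun c x).
Proof. by move=> cx; exists x. Qed.

Lemma near_cdom x : cdom c x -> \forall y \near x, cdom c y.
Proof. by move=> cx; apply: open_nbhs_nbhs; split=> //; exact: cdom_open. Qed.

Lemma near_cimg x : cdom c x -> \forall z \near cfun c x, cimg c z.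
Proof.
by move=> cx; apply: open_nbhs_nbhs; split; [exact: cimg_open|exact: dom_cimg].
Qed.

Lemma near_cinv (P : T -> Prop) x : cdom c x -> (\forall y \near x, P y) ->
  \forall z \near cfun c x, P (cinv c z).
Proof.
move=> cx Px; have := cinv_cont (dom_cimg cx).
by rewrite /prop_for /continuous_at cfunK// => /(_ P); exact.
Qed.

Lemma chart_image_open (U : set T) : open U -> open (cfun c @` (cdom c `&` U)).
Proof.
move=> oU; rewrite openE => _ [x [cx Ux] <-].
have nU : \forall y \near x, U y by exact: open_nbhs_nbhs.
have := near_cinv cx nU; have := near_cimg cx.
apply: filterS2 => z /cimg_dom[dz Ez] Uz; rewrite /interior/=.
by exists (cinv c z).
Qed.

End OneChart.

Section Maps.
Variables (m n : nat) (M : cmanifold R m) (N : cmanifold R n).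
Implicit Types (f g : M -> N).

Definition local_map (c : chart R M m) (c' : chart R N n) f
    (z : 'rV[C]_m) : 'rV[C]_n := cfun c' (f (cinv c z)).

Definition holo_map_at f (x : M) := {for x, continuous f} /\
  forall (c : chart R M m) (c' : chart R N n),
    atlas c -> atlas c' -> cdom c x -> cdom c' (f x) ->
    holo_at (local_map c c' f) (cfun c x).

Lemma holo_map_on_at (U : set M) f x : open U -> holo_map_on U f -> U x ->
  holo_map_at f x.
Proof.
move=> oU [cf hf] Ux; split=> [|c c' ac ac' cx c'fx]; first exact: cf.
exists (cfun c @` (cdom c `&` U `&` f @^-1` cdom c')); last exact: hf.
split; last by exists x.
rewrite -setIA; apply: chart_image_open.
rewrite openE => y [Uy c'fy]; rewrite /interior.
have nU : \forall y \near y, U y by exact: open_nbhs_nbhs.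
by apply: filterS2 nU (cf _ Uy _ (near_cdom c'fy)).
Qed.

Lemma holo_map_all f : holo_map f -> forall x, holo_map_at f x.
Proof. by move=> hf x; apply: holo_map_on_at hf _ => //; exact: openT. Qed.

Lemma chart_atP (x : M) : atlas (chart_at x) /\ cdom (chart_at x) x.
Proof. by rewrite /chart_at; case: (cid _). Qed.

Lemma dmap_linear (c : chart R M m) (c' : chart R N n) f x k u v : holo_map_at f x ->
  atlas c -> atlas c' -> cdom c x -> cdom c' (f x) ->
  dmap c c' f x (k *: u + v) = k *: dmap c c' f x u + dmap c c' f x v.
Proof.
by move=> [_ hf] ac ac' cx c'fx; apply: derive_linear; apply: holo_at_diff; exact: hf.
Qed.

Lemma dmap_near (c : chart R M m) (c' : chart R N n) f g x v :
  cdom c x -> (\forall y \near x, f y = g y) ->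
  dmap c c' f x v = dmap c c' g x v.
Proof.
move=> cx fg; apply: near_eq_derive.
by apply: filterS (near_cinv cx fg) => z ->.
Qed.

End Maps.

Lemma dmap_id n (M : cmanifold R n) c (x : M) v : cdom c x -> dmap c c idfun x v = v.
Proof.
move=> cx; rewrite /dmap -[RHS](derive_id (cfun c x) v); apply: near_eq_derive.
by apply: filterS (near_cimg cx) => z /cimg_dom[].
Qed.

Lemma holo_map_id m (M : cmanifold R m) (x : M) : holo_map_at (@idfun M) x.
Proof.
apply: (@holo_map_on_at _ _ _ _ setT) => //; first exact: openT.
split=> [y _|c c' ac ac']; first exact: cvg_id.
by have := cm_trans ac ac'; rewrite setIT.
Qed.

Section Composition.
Variables (m n p : nat).
Variables (M : cmanifold R m) (N : cmanifold R n) (P : cmanifold R p).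
Variables (f : M -> N) (g : N -> P) (x : M).
Hypotheses (hf : holo_map_at f x) (hg : holo_map_at g (f x)).

Lemma local_map_comp c c' c'' : cdom c x -> cdom c' (f x) ->
  \forall z \near cfun c x,
    local_map c c'' (g \o f) z = (local_map c' c'' g \o local_map c c' f) z.
Proof.
move=> cx c'fx; have nf : \forall y \near x, cdom c' (f y).
  by case: hf => cf _; exact: (cf _ (near_cdom c'fx)).
by apply: filterS (near_cinv cx nf) => z dz; rewrite /local_map /= cfunK.
Qed.

Lemma holo_map_comp : holo_map_at (g \o f) x.
Proof.
split=> [|c c'' ac ac'' cx c''x].
  by apply: continuous_comp; [case: hf|case: hg].
have [a' d'] := chart_atP (f x).
apply: (holo_at_eq (f := local_map (chart_at (f x)) c'' g \o local_map c (chart_at (f x)) f)).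
  apply: filterS (local_map_comp c'' cx d') => z; exact: esym.
apply: holo_at_comp; first by case: hf => _; exact.
by rewrite /local_map cfunK//; case: hg => _; exact.
Qed.

(** In charts this is the chain rule, since the local expression of a composite
    agrees near the point with the composite of the local expressions. *)
Lemma dmap_comp c c' c'' v : atlas c -> atlas c' -> atlas c'' ->
  cdom c x -> cdom c' (f x) -> cdom c'' (g (f x)) ->
  dmap c c'' (g \o f) x v = dmap c' c'' g (f x) (dmap c c' f x v).
Proof.
move=> ac ac' ac'' cx c'x c''x.
have df : differentiable (local_map c c' f) (cfun c x).
  by apply: holo_at_diff; case: hf => _; exact.
have dg : differentiable (local_map c' c'' g) (local_map c c' f (cfun c x)).
  by rewrite /local_map cfunK//; apply: holo_at_diff; case: hg => _; exact.
rewrite /dmap [LHS](near_eq_derive _ (local_map_comp c'' cx c'x)).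
by rewrite (derive_comp v df dg) [X in 'D_ _ _ X]/local_map cfunK.
Qed.

End Composition.

Section Transition.
Variables (m n : nat) (M : cmanifold R m) (N : cmanifold R n).

Lemma dmap_dtrans (f : M -> N) c c' c'' x v : holo_map_at f x ->
  atlas c -> atlas c' -> atlas c'' -> cdom c x -> cdom c' x -> cdom c'' (f x) ->
  dmap c' c'' f x (dtrans c c' x v) = dmap c c'' f x v.
Proof.
move=> hf ac ac' ac'' cx c'x c''x.
by rewrite /dtrans -(dmap_comp (f := idfun) (holo_map_id x) hf).
Qed.

Lemma dtrans_dmap (f : M -> N) c c' c'' x v : holo_map_at f x ->
  atlas c -> atlas c' -> atlas c'' -> cdom c x -> cdom c' (f x) -> cdom c'' (f x) ->
  dtrans c' c'' (f x) (dmap c c' f x v) = dmap c c'' f x v.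
Proof.
move=> hf ac ac' ac'' cx c'x c''x.
by rewrite /dtrans -(dmap_comp (g := idfun) hf (holo_map_id (f x))).
Qed.

End Transition.
End Charts.

(** * Differential forms, pullback and exterior derivative *)

Section Forms.
Variable R : realType.
Local Notation C := (Cx R).

Section OneManifold.
Variables (n : nat) (N : cmanifold R n) (U : set N).
Hypothesis oU : open U.

Lemma near_open (x : N) : U x -> \forall y \near x, U y.
Proof. by move=> Ux; exact: open_nbhs_nbhs. Qed.

Lemma form1_holo (a : form1 N) c y v : is_form1 U a -> atlas c -> cdom c y ->
  U y -> holo_at (fun z => a c (cinv c z) v) (cfun c y).
Proof.
move=> [_ ha _] ac cy Uy; exists (cfun c @` (cdom c `&` U)); last exact: ha.
by split; [exact: chart_image_open|exists y].
Qed.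

(** The expansion along a basis turns a form evaluated on a varying vector into a
    finite sum of products of scalar functions. *)
Lemma form1_row (a : form1 N) c y v : is_form1 U a -> atlas c -> cdom c y ->
  U y -> a c y v = \sum_j v 0 j * a c y (delta_mx 0 j).
Proof.
move=> [la _ _] ac cy Uy; have l := la c y ac cy Uy.
pose L := GRing.isLinear.Build C 'rV[C]_n C *%R (a c y) l.
pose F : {linear 'rV[C]_n -> C | *%R} := HB.pack (a c y) L.
rewrite -[LHS]/(F v) [in LHS](row_sum_delta v) linear_sum.
by apply: eq_bigr => j _; rewrite linearZ.
Qed.

Lemma is_form1S (U' : set N) (a : form1 N) : U' `<=` U -> open U' ->
  is_form1 U a -> is_form1 U' a.
Proof.
move=> sU oU' fa; have [la _ ia] := fa; split.
- by move=> c x ac cx /sU; exact: la.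
- move=> c v ac; apply/holo_on_at; first exact: chart_image_open.
  by move=> _ [x [cx /sU Ux] <-]; exact: form1_holo.
- by move=> c c' x v ac ac' cx c'x /sU; exact: ia.
Qed.

Lemma is_form2_eq (a b : form2 N) : eq2 U a b -> is_form2 U a -> is_form2 U b.
Proof.
move=> ab [la sa ha ia]; split.
- by move=> c x ac cx Ux k u v w; rewrite -!ab//; exact: la.
- by move=> c x ac cx Ux u v; rewrite -!ab//; exact: sa.
- move=> c u v ac k; apply: cdiffn_eq (ha c u v ac k); first exact: chart_image_open.
  by move=> _ [x [cx Ux] <-]; rewrite cfunK// ab.
- by move=> c c' x u v ac ac' cx c'x Ux; rewrite -!ab//; exact: ia.
Qed.

Lemma closed2_eq (a b : form2 N) : eq2 U a b -> closed2 U a -> closed2 U b.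
Proof.
move=> ab ca c x u v w ac cx Ux; rewrite -(ca c x u v w ac cx Ux).
have E w1 w2 : \forall z \near cfun c x, b c (cinv c z) w1 w2 = a c (cinv c z) w1 w2.
  have H := near_cinv cx (near_open Ux); have H' := near_cimg cx.
  by apply: filterS2 H H' => z Uz /cimg_dom[dz _]; rewrite ab.
by rewrite !(near_eq_derive _ (E _ _)).
Qed.

Lemma d1_local (a : form1 N) c x u v : cdom c x -> \forall z \near cfun c x,
  d1 a c (cinv c z) u v =
  'D_u (fun z => a c (cinv c z) v) z - 'D_v (fun z => a c (cinv c z) u) z.
Proof. by move=> cx; apply: filterS (near_cimg cx) => z /cimg_dom[_ Ez]; rewrite /d1 Ez. Qed.

(** The six second derivatives cancel in pairs by symmetry. *)
Lemma d1_closed (a : form1 N) : is_form1 U a -> closed2 U (d1 a).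
Proof.
move=> fa c x u v w ac cx Ux.
pose A w z := a c (cinv c z) w.
have hA w1 : holo_at (A w1) (cfun c x) by exact: form1_holo.
have dA w1 w2 w3 : derivable ('D_w2 (A w1)) (cfun c x) w3.
  by apply: diff_derivable; exact/holo_at_diff/holo_at_derive.
have D w1 w2 w3 : 'D_w1 (fun z => d1 a c (cinv c z) w2 w3) (cfun c x) =
    'D_w1 ('D_w2 (A w3)) (cfun c x) - 'D_w1 ('D_w3 (A w2)) (cfun c x).
  rewrite (near_eq_derive w1 (d1_local a w2 w3 cx)).
  exact: (deriveB (dA w3 w2 w1) (dA w2 w3 w1)).
(* the three instances of the symmetry of second derivatives pair the terms *)
have cyc (p q r s t t' : C) : p = s -> r = t' -> t = q ->
    p - q + (r - s) + (t - t') = 0 by move=> -> -> ->; ring.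
etransitivity; first exact: (congr2 +%R (congr2 +%R (D u v w) (D v w u)) (D w u v)).
exact: (cyc _ _ _ _ _ _ (holo_schwarz u v (hA w)) (holo_schwarz v w (hA u))
  (holo_schwarz w u (hA v))).
Qed.

End OneManifold.

Section Pullback.
Variables (m n : nat) (M : cmanifold R m) (N : cmanifold R n) (f : M -> N).

(** The definition of the pullback uses a chart chosen at each point of the
    target, with no continuity in the point; for a form, any fixed chart gives
    the same value, and can be kept on a whole neighbourhood. *)
Lemma pull1_chart (U : set N) (a : form1 N) c c' x v : is_form1 U a ->
  holo_map_at f x -> atlas c -> atlas c' -> cdom c x -> cdom c' (f x) -> U (f x) ->
  pull1 f a c x v = a c' (f x) (dmap c c' f x v).
Proof.
move=> [_ _ ia] hf ac ac' cx c'x Ux; have [a'' c''x] := chart_atP (f x).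
etransitivity; last exact: (ia _ _ _ _ ac' a'' c'x c''x Ux).
have E w := esym (dtrans_dmap w hf ac ac' a'' cx c'x c''x).
exact: (congr1 (a (chart_at (f x)) (f x)) (E v)).
Qed.

Lemma pull2_chart (U : set N) (a : form2 N) c c' x u v : is_form2 U a ->
  holo_map_at f x -> atlas c -> atlas c' -> cdom c x -> cdom c' (f x) -> U (f x) ->
  pull2 f a c x u v = a c' (f x) (dmap c c' f x u) (dmap c c' f x v).
Proof.
move=> [_ _ _ ia] hf ac ac' cx c'x Ux; have [a'' c''x] := chart_atP (f x).
etransitivity; last exact: (ia _ _ _ _ _ ac' a'' c'x c''x Ux).
have E w := esym (dtrans_dmap w hf ac ac' a'' cx c'x c''x).
exact: (congr2 (a (chart_at (f x)) (f x)) (E u) (E v)).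
Qed.

Lemma eq2_pull2 (U : set N) (a b : form2 N) : eq2 U a b ->
  eq2 (f @^-1` U) (pull2 f a) (pull2 f b).
Proof.
move=> ab c x u v ac cx Ux; have [a' c'x] := chart_atP (f x).
by rewrite /pull2 ab.
Qed.

Hypothesis hf : forall x, holo_map_at f x.
Variables (U : set N) (a : form1 N).
Hypotheses (oU : open U) (fa : is_form1 U a).

Lemma pull1_local c c' x v : atlas c -> atlas c' -> cdom c x -> cdom c' (f x) ->
  U (f x) -> \forall z \near cfun c x,
  pull1 f a c (cinv c z) v = \sum_j ('D_v (local_map c c' f) z) 0 j *
    a c' (cinv c' (local_map c c' f z)) (delta_mx 0 j).
Proof.
move=> ac ac' cx c'x Ux; have [cf _] := hf x.
have H1 := near_cinv cx (cf _ (near_cdom c'x)).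
have H2 := near_cinv cx (cf _ (near_open oU Ux)).
apply: filterS3 H1 H2 (near_cimg cx) => z d'z Uz /cimg_dom[dz Ez].
rewrite (pull1_chart (c' := c') _ fa) // (form1_row _ fa)//.
by rewrite /dmap Ez /local_map cfunK.
Qed.

Lemma holo_form1_comp c c' x w : atlas c -> atlas c' -> cdom c x ->
  cdom c' (f x) -> U (f x) ->
  holo_at (fun z => a c' (cinv c' (local_map c c' f z)) w) (cfun c x).
Proof.
move=> ac ac' cx c'x Ux.
apply: (holo_at_comp_scalar (g := fun y => a c' (cinv c' y) w)).
  by case: (hf x) => _; exact.
by rewrite /local_map cfunK//; exact: (form1_holo oU).
Qed.

Let open_preimage : open (f @^-1` U).
Proof. by apply: open_comp => // x _; case: (hf x). Qed.

Lemma pull1_form1 : is_form1 (f @^-1` U) (pull1 f a).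
Proof.
split=> [c x ac cx Ux k u v|c v ac|c c' x v ac ac' cx c'x Ux].
- have [a' c'x] := chart_atP (f x); have [la _ _] := fa.
  by rewrite /pull1 dmap_linear// la.
- apply/holo_on_at; first exact: chart_image_open open_preimage.
  move=> _ [x [cx Ux] <-]; have [a' c'x] := chart_atP (f x).
  pose c' := chart_at (f x).
  apply: (holo_at_eq (f := fun z => \sum_j ('D_v (local_map c c' f) z) 0 j *
    a c' (cinv c' (local_map c c' f z)) (delta_mx 0 j))).
    by apply: filterS (pull1_local v ac a' cx c'x Ux) => z /esym; exact.
  apply: holo_at_sum => j; apply: holo_at_mul; last exact: holo_form1_comp.
  by apply: holo_at_coord; apply: holo_at_derive; case: (hf x) => _; exact.
- have [a' c''x] := chart_atP (f x).
  by rewrite /pull1 dmap_dtrans.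
Qed.

(** Besides the exterior derivative of [a], differentiating the pullback produces
    terms in the second derivatives of [f], which are symmetric and so disappear
    in the antisymmetrisation. *)
Lemma d1_pull1_chart c c' x u v : atlas c -> atlas c' -> cdom c x ->
  cdom c' (f x) -> U (f x) ->
  d1 (pull1 f a) c x u v = d1 a c' (f x) (dmap c c' f x u) (dmap c c' f x v).
Proof.
move=> ac ac' cx c'x Ux.
set G := local_map c c' f; pose z0 := cfun c x.
pose A j z := a c' (cinv c' z) (delta_mx 0 j).
have hG : holo_at G z0 by case: (hf x) => _; exact.
have hA j : holo_at (A j) (G z0).
  by rewrite /G /local_map /z0 cfunK//; exact: (form1_holo oU).
have hAG j : holo_at (A j \o G) z0 by exact: holo_at_comp_scalar.
have hDG w j : holo_at (fun z => ('D_w G z) 0 j) z0.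
  exact/holo_at_coord/holo_at_derive.
have dd (g : 'rV[C]_m -> C) w : holo_at g z0 -> derivable g z0 w.
  by move=> hg; apply: diff_derivable; exact: holo_at_diff.
have Gz0 : G z0 = cfun c' (f x) by rewrite /G /local_map /z0 cfunK.
have D w1 w2 : 'D_w1 (fun z => pull1 f a c (cinv c z) w2) z0 =
    \sum_j (('D_w2 G z0) 0 j * 'D_('D_w1 G z0) (A j) (G z0) +
            A j (G z0) * ('D_w1 ('D_w2 G) z0) 0 j).
  have E : \forall z \near z0, pull1 f a c (cinv c z) w2 =
      (\sum_j (fun z => ('D_w2 G z) 0 j * (A j \o G) z)) z.
    by apply: filterS (pull1_local w2 ac ac' cx c'x Ux) => z ->; rewrite fct_sumE.
  rewrite (near_eq_derive w1 E) derive_sum; last first.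
    by move=> j; apply: dd; exact: holo_at_mul.
  apply: eq_bigr => j _.
  rewrite [LHS](deriveM (dd _ w1 (hDG w2 j)) (dd _ w1 (hAG j))).
  rewrite (derive_comp w1 (holo_at_diff hG) (holo_at_diff (hA j))).
  rewrite (@derive_coord _ _ _ ('D_w2 G)) //.
  exact/holo_at_diff/holo_at_derive.
have D' w1 w2 : 'D_w1 (fun z => a c' (cinv c' z) w2) (cfun c' (f x)) =
    \sum_j w2 0 j * 'D_w1 (A j) (G z0).
  have E0 : \forall z \near cfun c' (f x), a c' (cinv c' z) w2 =
      (\sum_j (w2 0 j \*: A j)) z.
    apply: filterS2 (near_cimg c'x) (near_cinv c'x (near_open oU Ux)) => z.
    by move=> /cimg_dom[dz _] Uz; rewrite fct_sumE; exact: (form1_row _ fa).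
  rewrite (near_eq_derive w1 E0).
  have dA j : derivable (A j) (cfun c' (f x)) w1.
    by apply: diff_derivable; apply: holo_at_diff; rewrite -Gz0.
  rewrite derive_sum; last by move=> j; exact: derivableZ.
  by rewrite Gz0; apply: eq_bigr => j _; exact: (deriveZ (w2 0 j) (dA j)).
etransitivity; first exact: (congr2 (fun p q => p - q) (D u v) (D v u)).
apply/esym; etransitivity.
  exact: (congr2 (fun p q => p - q) (D' (dmap c c' f x u) (dmap c c' f x v))
    (D' (dmap c c' f x v) (dmap c c' f x u))).
rewrite -!sumrB; apply: eq_bigr => j _.
have S : ('D_u ('D_v G) z0) 0 j = ('D_v ('D_u G) z0) 0 j.
  have hGj := holo_at_coord j hG.
  have E w : \forall z \near z0, ('D_w G z) 0 j = 'D_w (fun z => G z 0 j) z.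
    by apply: filterS (holo_at_near hG) => z /holo_at_diff dz; rewrite derive_coord.
  have dDG w : differentiable ('D_w G) z0 by exact/holo_at_diff/holo_at_derive.
  have D2 w1 w2 : ('D_w1 ('D_w2 G) z0) 0 j = 'D_w1 ('D_w2 (fun z => G z 0 j)) z0.
    by rewrite -(derive_coord w1 j (dDG w2)); exact: (near_eq_derive w1 (E w2)).
  exact: (etrans (D2 u v) (etrans (holo_schwarz u v hGj) (esym (D2 v u)))).
have alg (p q r s t : C) : s = t -> p - q = (p + r * s) - (q + r * t).
  by move=> ->; ring.
exact: (alg _ _ _ _ _ S).
Qed.

Lemma d1_pull1 : eq2 (f @^-1` U) (d1 (pull1 f a)) (pull2 f (d1 a)).
Proof.
move=> c x u v ac cx Ux; have [a' c'x] := chart_atP (f x).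
exact: d1_pull1_chart.
Qed.

End Pullback.

(** Independence of the chart is the compatibility of [d1] with the pullback by
    the identity map. *)
Lemma d1_form2 n (N : cmanifold R n) (U : set N) (a : form1 N) : open U ->
  is_form1 U a -> is_form2 U (d1 a).
Proof.
move=> oU fa; have hid (x : N) := holo_map_id x.
have dA c x w1 w2 : atlas c -> cdom c x -> U x ->
    derivable (fun z => a c (cinv c z) w1) (cfun c x) w2.
  by move=> ac cx Ux; apply: diff_derivable; apply: holo_at_diff; exact: (form1_holo oU).
split.
- move=> c x ac cx Ux k u v w; rewrite /d1.
  rewrite derive_linear; last by apply: holo_at_diff; exact: (form1_holo oU).
  have E : \forall z \near cfun c x, a c (cinv c z) (k *: u + v) =
     ((k \*: (fun z => a c (cinv c z) u)) + (fun z => a c (cinv c z) v)) z.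
    apply: filterS2 (near_cimg cx) (near_cinv cx (near_open oU Ux)) => z.
    by move=> /cimg_dom[dz _] Uz; case: fa => la _ _; rewrite la.
  rewrite (near_eq_derive _ E) deriveD; [|exact/derivableZ/dA|exact: dA].
  rewrite deriveZ; last exact: dA.
  have alg (k' p q r s : C) :
      k' *: p + q - (k' *: r + s) = k' * (p - r) + (q - s).
    by rewrite /GRing.scale /=; ring.
  exact: alg.
- by move=> c x ac cx Ux u v; rewrite /d1 opprB.
- move=> c u v ac; apply/holo_on_at; first exact: chart_image_open.
  move=> _ [x [cx Ux] <-].
  apply: (holo_at_eq (f := fun z => 'D_u (fun z => a c (cinv c z) v) z -
    'D_v (fun z => a c (cinv c z) u) z)).
    by apply: filterS (d1_local a u v cx) => z /esym; exact.
  apply: holo_at_add; first by apply: holo_at_derive; exact: (form1_holo oU).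
  rewrite (_ : (fun y => - _) = fun y => (-1) * 'D_v (fun z => a c (cinv c z) u) y).
    by apply: holo_at_scale; apply: holo_at_derive; exact: (form1_holo oU).
  by apply/funext => y; rewrite mulN1r.
- move=> c c' x u v ac ac' cx c'x Ux.
  etransitivity; first exact: (esym (d1_pull1_chart hid oU fa _ _ ac ac' cx c'x Ux)).
  have E w : \forall z \near cfun c x, pull1 idfun a c (cinv c z) w = a c (cinv c z) w.
    apply: filterS2 (near_cimg cx) (near_cinv cx (near_open oU Ux)) => z.
    move=> /cimg_dom[dz Ez] Uz; rewrite (pull1_chart (c' := c) _ fa)//.
    exact: (congr1 (a c (cinv c z)) (dmap_id w dz)).
  exact: (congr2 (fun p q => p - q) (near_eq_derive u (E v)) (near_eq_derive v (E u))).
Qed.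

End Forms.

(** * Linear maps and the tangent bundle *)

Section LinearMaps.
Variable R : realType.
Local Notation C := (Cx R).
Variables (m : nat) (W : normedModType C) (f : 'rV[C]_m -> W).
Hypothesis lf : linear f.

Let fM := GRing.isLinear.Build C 'rV[C]_m W *:%R f lf.
Let F : {linear 'rV[C]_m -> W} := HB.pack f fM.

Let cF : continuous F.
Proof.
have -> : (F : _ -> _) = \sum_j (fun z => coord j z *: F (delta_mx 0 j)).
  apply/funext => z; rewrite fct_sumE [in LHS](row_sum_delta z) linear_sum.
  by apply: eq_bigr => j _; rewrite linearZ.
move=> w; apply: differentiable_continuous; apply: differentiable_sum => j.
by apply: differentiableZl; exact: differentiable_coord.
Qed.

Lemma linear_rV_continuous : continuous f. Proof. exact: cF. Qed.

Lemma derive_lin x v : 'D_v f x = f v.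
Proof.
rewrite -[f]/(F : _ -> _) deriveE; last exact: linear_differentiable.
by rewrite diff_lin.
Qed.

Lemma holo_at_linear x : holo_at f x.
Proof. exact: (holo_at_linear_comp (L := F) (f := id) cF (holo_at_id x)). Qed.

End LinearMaps.

Section TangentBundle.
Variable R : realType.
Local Notation C := (Cx R).

Section Projection.
Variables (n : nat) (M : cmanifold R n) (X : cmanifold R (n + n)).
Variables (proj : X -> M) (base : chart R X (n + n) -> chart R M n).
Hypothesis tb : tangent_bundle proj base.

Lemma tangent_base c x : atlas c -> cdom c x -> cdom (base c) (proj x).
Proof. by move=> ac; rewrite (tb_dom tb ac). Qed.

Lemma lsubmx_lin p q : linear (lsubmx : 'rV[C]_(p + q) -> 'rV[C]_p).
Proof. exact: linearP. Qed.

Lemma proj_local c c' x : atlas c -> cdom c x ->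
  \forall z \near cfun c x,
    local_map c c' proj z = local_map (base c) c' idfun (lsubmx z).
Proof.
move=> ac cx; apply: filterS (near_cimg cx) => z /cimg_dom[dz Ez].
rewrite /local_map /= -{2}Ez (tb_proj tb ac dz) cfunK //; exact: tangent_base.
Qed.

Lemma proj_holo x : holo_map_at proj x.
Proof.
split=> [|c c' ac ac' cx c'x].
  have [ac cx] := chart_atP x; set c := chart_at x in ac cx.
  have E : \forall y \near x, cinv (base c) (lsubmx (cfun c y)) = proj y.
    apply: filterS (near_cdom cx) => y cy.
    by rewrite (tb_proj tb ac cy) cfunK//; exact: tangent_base.
  have c0 : {for cfun (base c) (proj x), continuous (cinv (base c))}.
    by apply: cinv_cont; exact/dom_cimg/tangent_base.
  rewrite /prop_for /continuous_at -(nbhs_singleton E).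
  apply: cvg_trans (near_eq_cvg E) _.
  apply: (@continuous_comp _ _ _ (fun y => lsubmx (cfun c y)) (cinv (base c))).
    apply: (@continuous_comp _ _ _ (cfun c) lsubmx); first exact: cfun_cont.
    exact: linear_rV_continuous (@lsubmx_lin n n) _.
  by rewrite (tb_proj tb ac cx).
apply: (holo_at_eq (f := local_map (base c) c' idfun \o lsubmx)).
  by apply: filterS (proj_local c' ac cx) => z /esym.
apply: holo_at_comp; first exact: holo_at_linear (@lsubmx_lin n n) _.
rewrite (tb_proj tb ac cx); case: (holo_map_id (proj x)) => _; apply=> //.
  exact: (tb_base tb).
exact: tangent_base.
Qed.

Lemma dmap_proj c x v : atlas c -> cdom c x -> dmap c (base c) proj x v = lsubmx v.
Proof.
move=> ac cx; rewrite /dmap -(derive_lin (@lsubmx_lin n n) (cfun c x) v).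
apply: near_eq_derive; apply: filterS (near_cimg cx) => z /cimg_dom[dz Ez].
by rewrite -(tb_proj tb ac dz) Ez.
Qed.

Hypothesis pM : period_structure M.

(** Transition functions between integral linear charts are locally constant
    linear maps, so those of the tangent bundle are the same linear map acting on
    [z] and on [theta]. *)
Lemma tangent_transition c c' x : atlas c -> atlas c' -> cdom c x -> cdom c' x ->
  exists A : 'M[C]_n,
    [/\ forall v, dtrans (base c) (base c') (proj x) v = v *m A,
        lsubmx (cfun c' x) = lsubmx (cfun c x) *m A &
        forall v, dtrans c c' x v = row_mx (lsubmx v *m A) (rsubmx v *m A)].
Proof.
move=> ac ac' cx c'x.
have ab := tb_base tb ac; have ab' := tb_base tb ac'.
have [A0 _ nA] := pM ab ab' (tangent_base ac cx) (tangent_base ac' c'x).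
pose A : 'M[C]_n := map_mx intr A0; exists A.
have lA : linear (fun v : 'rV[C]_n => v *m A).
  by move=> k u v; rewrite mulmxDl -scalemxAl.
have dA y v : cdom (base c) y ->
    (\forall y' \near y, cfun (base c') y' = cfun (base c) y' *m A) ->
    dtrans (base c) (base c') y v = v *m A.
  move=> cy yA; rewrite -(derive_lin lA (cfun (base c) y) v); apply: near_eq_derive.
  by apply: filterS2 (near_cimg cy) (near_cinv cy yA) => z /cimg_dom[dz Ez] -> /=; rewrite Ez.
have nx : \forall y \near x,
    cfun c' y = row_mx (lsubmx (cfun c y) *m A) (rsubmx (cfun c y) *m A).
  have cp : {for x, continuous proj} by case: (proj_holo x).
  have nA' : \forall y \near x, \forall y' \near proj y,
      cfun (base c') y' = cfun (base c) y' *m A.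
    exact: (cp _ (near_join nA)).
  apply: filterS3 nA' (near_cdom cx) (near_cdom c'x) => y yA cy c'y.
  rewrite -[LHS]hsubmxK (tb_fibre tb ac ac' cy c'y) (tb_proj tb ac' c'y).
  rewrite (dA _ _ (tangent_base ac cy) yA) (nbhs_singleton yA).
  by rewrite -(tb_proj tb ac cy).
split=> [v||v]; first exact: dA (tangent_base ac cx) nA.
  by rewrite (nbhs_singleton nx) row_mxKl.
have lx : linear (fun v : 'rV[C]_(n + n) => row_mx (lsubmx v *m A) (rsubmx v *m A)).
  by move=> k u w; rewrite !linearP /= !mulmxDl -!scalemxAl scale_row_mx add_row_mx.
rewrite -(derive_lin lx (cfun c x) v); apply: near_eq_derive.
by apply: filterS2 (near_cimg cx) (near_cinv cx nx) => z /cimg_dom[dz Ez] -> /=; rewrite Ez.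
Qed.

End Projection.
End TangentBundle.

(** * The forms of a Joyce structure *)

Section JoyceForms.
Variable R : realType.
Local Notation C := (Cx R).
Variables (n : nat) (M : cmanifold R n) (J : joyce_structure M).
Local Notation X := (jX J).

(** Antisymmetry of the coefficients absorbs the factor one half. *)
Lemma matrix_form_anti (om : chart R M n -> 'M[C]_n) c x u v :
  (om c)^T = - om c ->
  matrix_form om c x u v = \sum_p \sum_q om c p q * (u 0 p * v 0 q).
Proof.
move=> om_anti.
have omE p q : om c q p = - om c p q.
  by move/matrixP/(_ p q): om_anti; rewrite !mxE.
set S := RHS.
have -> : matrix_form om c x u v = 2%:R^-1 * (S + S).
  have S' : S = \sum_p \sum_q om c q p * (u 0 q * v 0 p) by exact: exchange_big.
  congr (_ * _); rewrite [X in S + X]S' -big_split; apply: eq_bigr => p _.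
  rewrite -big_split; apply: eq_bigr => q _; rewrite (omE p q) /wedge /=; ring.
have -> : S + S = 2%:R * S by ring.
by rewrite mulKf// pnatr_eq0.
Qed.

Lemma jom_anti_base c : atlas c -> (jom J (jbase J c))^T = - jom J (jbase J c).
Proof. by move=> ac; apply: jom_anti; exact: (tb_base (jX_tangent J)). Qed.

Lemma mul2iK (s : C) : 2%:R * 'i * ((2%:R * 'i)^-1 * s) = s.
Proof. by rewrite mulVKf// mulf_neq0 ?pnatr_eq0// neq0Ci. Qed.

(** In coordinates, [2i Theta_I = - omega(z, dtheta)] with [omega] the constant
    bilinear form of coefficients [omega_pq]: expressed through [Omega0], it
    inherits its transformation rule. *)
Lemma twoi_Theta_IE c x v : atlas c ->
  twoi_Theta_I J c x v =
    - Omega0 J (jbase J c) (jpi J x) (lsubmx (cfun c x)) (rsubmx v).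
Proof.
move=> ac; rewrite /Omega0 matrix_form_anti; last exact: jom_anti_base.
rewrite /twoi_Theta_I /scale1 /Theta_I /interior1 /Omega_I mul2iK.
congr (- _); apply: eq_bigr => p _; apply: eq_bigr => q _; congr (_ * _).
by rewrite /wedge /dfst /dsnd /euler_X row_mxKl row_mxKr !mxE mulr0 subr0.
Qed.

Lemma twoi_Omega_IE c x u v : atlas c ->
  twoi_Omega_I J c x u v =
    - (Omega0 J (jbase J c) (jpi J x) (lsubmx u) (rsubmx v) -
       Omega0 J (jbase J c) (jpi J x) (lsubmx v) (rsubmx u)).
Proof.
move=> ac; rewrite /Omega0 !matrix_form_anti; do ?exact: jom_anti_base.
rewrite /twoi_Omega_I /scale2 /Omega_I mul2iK -sumrB.
congr (- _); apply: eq_bigr => p _; rewrite -sumrB; apply: eq_bigr => q _.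
by rewrite -mulrBr.
Qed.

Lemma Omega0_form2 : is_form2 setT (Omega0 J).
Proof. by case: (jom_symplectic J). Qed.

Lemma Omega0_lin c y k u v w : atlas c -> cdom c y ->
  Omega0 J c y (k *: u + v) w = k * Omega0 J c y u w + Omega0 J c y v w.
Proof. by move=> ac cy; case: Omega0_form2 => l _ _ _; exact: l. Qed.

Lemma Omega0_linr c y k u v w : atlas c -> cdom c y ->
  Omega0 J c y w (k *: u + v) = k * Omega0 J c y w u + Omega0 J c y w v.
Proof.
move=> ac cy; case: Omega0_form2 => l s _ _.
by rewrite (s c y) // l // opprD -mulrN -!(s c y).
Qed.

Lemma twoi_Theta_I_linear c x w : atlas c -> cdom c x ->
  linear (fun z : 'rV[C]_(n + n) =>
    - Omega0 J (jbase J c) (jpi J x) (lsubmx z) w).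
Proof.
move=> ac cx k u v; have tb := jX_tangent J.
rewrite linearP Omega0_lin; first by rewrite opprD -mulrN.
  exact: (tb_base tb).
exact: (tangent_base tb).
Qed.

Lemma twoi_Theta_I_local c x v : atlas c -> cdom c x ->
  \forall z \near cfun c x, twoi_Theta_I J c (cinv c z) v =
    - Omega0 J (jbase J c) (jpi J x) (lsubmx z) (rsubmx v).
Proof.
move=> ac cx; apply: filterS (near_cimg cx) => z /cimg_dom[dz Ez].
by rewrite twoi_Theta_IE// Ez.
Qed.

(** The coefficients are linear in [z]; invariance under a change of chart holds
    because [z] and [theta] transform by the same matrix as tangent vectors of
    [M], under which [Omega0] is invariant. *)
Lemma twoi_Theta_I_form1 : is_form1 setT (twoi_Theta_I J).
Proof.
have tb := jX_tangent J.
split=> [c x ac cx _ k u v|c v ac|c c' x v ac ac' cx c'x _].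
- rewrite !twoi_Theta_IE// linearP Omega0_linr; first by rewrite opprD -mulrN.
    exact: (tb_base tb).
  exact: (tangent_base tb).
- apply/holo_on_at; first by apply: chart_image_open; exact: openT.
  move=> _ [x [cx _] <-].
  apply: (holo_at_eq (f := fun z => - Omega0 J (jbase J c) (jpi J x) (lsubmx z) (rsubmx v))).
    by apply: filterS (twoi_Theta_I_local v ac cx) => z /esym.
  by apply: holo_at_linear; exact: twoi_Theta_I_linear.
- have [A [dA lA dcA]] := tangent_transition tb (j_period J) ac ac' cx c'x.
  rewrite !twoi_Theta_IE// lA dcA row_mxKr -!dA; congr (- _).
  case: Omega0_form2 => _ _ _ i; apply: i => //; do ?exact: (tb_base tb).
    exact: (tangent_base tb).
  exact: (tangent_base tb).
Qed.

Lemma d1_twoi_Theta_I : eq2 setT (d1 (twoi_Theta_I J)) (twoi_Omega_I J).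
Proof.
move=> c x u v ac cx _; rewrite twoi_Omega_IE//.
have D w1 w2 : 'D_w1 (fun z => twoi_Theta_I J c (cinv c z) w2) (cfun c x) =
    - Omega0 J (jbase J c) (jpi J x) (lsubmx w1) (rsubmx w2).
  etransitivity; first exact: near_eq_derive w1 (twoi_Theta_I_local w2 ac cx).
  exact: (derive_lin (twoi_Theta_I_linear (rsubmx w2) ac cx)).
etransitivity; first exact: (congr2 (fun p q => p - q) (D u v) (D v u)).
by rewrite opprB opprK addrC.
Qed.

Lemma pull2_jpi_Omega0 : eq2 setT (pull2 (jpi J) (Omega0 J)) (Omega_plus J).
Proof.
move=> c x u v ac cx _; have tb := jX_tangent J.
rewrite (pull2_chart (c' := jbase J c) _ _ Omega0_form2) //.
- by rewrite !(dmap_proj tb).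
- exact: proj_holo tb x.
- exact: (tb_base tb).
- exact: (tangent_base tb).
Qed.

End JoyceForms.

(** * Tangent vectors of a submanifold *)

Section Tangents.
Variable R : realType.
Local Notation C := (Cx R).

Lemma diff_eps_near (V W : normedModType C) (f : V -> W) x (e : C) :
  differentiable f x -> 0 < e ->
  \forall y \near x, `|f y - f x - 'd f x (y - x)| <= e * `|y - x|.
Proof.
move=> df e0; rewrite (near_shift (0 : V)) /=.
apply: filterS (diff_eps df e0) => h /=.
by rewrite subr0 addrK [h + x]addrC.
Qed.

Lemma le_eps_eq0 (a b : C) : 0 <= a -> 0 <= b ->
  (forall e, 0 < e -> a <= e * b) -> a = 0.
Proof.
move=> a0 b0 H; apply/eqP; apply/negP => /negP na.
have ap : 0 < a by rewrite lt_def na.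
have b1 : 0 < b + 1 by rewrite ltr_wpDl.
have := H (a / (b + 1)) (divr_gt0 ap b1).
rewrite mulrAC ler_pdivlMr// ler_pM2l//.
by rewrite -subr_ge0 opprD addrA subrr add0r oppr_ge0 ler10.
Qed.

Lemma injective_left_inverse m n (f : 'rV[C]_m -> 'rV[C]_n) :
  linear f -> injective f -> exists P : 'M[C]_(n, m), forall v, f v *m P = v.
Proof.
move=> lf injf.
pose fM := GRing.isLinear.Build C 'rV[C]_m 'rV[C]_n *:%R f lf.
pose F : {linear 'rV[C]_m -> 'rV[C]_n} := HB.pack f fM.
have fE v : f v = v *m lin1_mx F by rewrite mul_rV_lin1.
have /row_freeP[P AP] : row_free (lin1_mx F).
  apply: inj_row_free => v; rewrite -fE => fv0; apply: injf.
  by rewrite fv0 -[RHS]/(F 0) linear0.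
by exists P => v; rewrite fE -mulmxA AP mulmx1.
Qed.

Lemma linear_bounded m (W : normedModType C) (f : 'rV[C]_m -> W) : linear f ->
  exists2 k : C, 0 < k & forall v, `|f v| <= k * `|v|.
Proof.
move=> lf; pose fM := GRing.isLinear.Build C 'rV[C]_m W *:%R f lf.
pose F : {linear 'rV[C]_m -> W} := HB.pack f fM.
have cF : continuous F by exact: (linear_rV_continuous lf).
have [k k0 H] := linear_lipschitz cF.
by exists k.
Qed.

(** The continuous factor [kappa] is not known to be differentiable, but its
    increments are [O(z - z0)], because the injective differential of [H] has a
    left inverse [P]. Hence the component [Q] of the differential of [G]
    transverse to the image of that of [H] is [o(z - z0)], so it vanishes. *)
Lemma differential_factor p m n (G : 'rV[C]_p -> 'rV[C]_n)
    (H : 'rV[C]_m -> 'rV[C]_n) (kappa : 'rV[C]_p -> 'rV[C]_m) z0 :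
  differentiable G z0 -> differentiable H (kappa z0) ->
  {for z0, continuous kappa} -> (\forall z \near z0, G z = H (kappa z)) ->
  injective ('d H (kappa z0)) ->
  forall u, exists w, 'd G z0 u = 'd H (kappa z0) w.
Proof.
move=> dG dH ck GH injH u; set w0 := kappa z0.
have [P HP] := injective_left_inverse (linearP ('d H w0)) injH.
pose Q (y : 'rV[C]_n) := y - 'd H w0 (y *m P).
have lQ : linear Q.
  by move=> a y y'; rewrite /Q mulmxDl -scalemxAl linearP opprD addrACA scalerBr.
have QH w : Q ('d H w0 w) = 0 by rewrite /Q HP subrr.
have QB y y' : Q (y - y') = Q y - Q y'.
  by rewrite -[y - y']addrC -scaleN1r lQ scaleN1r addrC.
have lP : linear (fun y : 'rV[C]_n => y *m P).
  by move=> a y y'; rewrite mulmxDl -scalemxAl.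
have [KQ KQ0 bQ] := linear_bounded lQ.
have [KP KP0 bP] := linear_bounded lP.
have [D D0 bD] := linear_bounded (linearP ('d G z0)).
pose c := 2%:R * KP * (D + 1).
(* small enough for the error term of [kappa] to be absorbed *)
pose e1 : C := (2%:R * KP)^-1.
have KP2 : 0 < 2%:R * KP by rewrite mulr_gt0.
have e10 : 0 < e1 by rewrite invr_gt0.
have c0 : 0 <= c by rewrite mulr_ge0 ?ltW// addr_gt0.
have GHz0 := nbhs_singleton GH.
have nH e : 0 < e -> \forall z \near z0,
    `|G z - G z0 - 'd H w0 (kappa z - w0)| <= e * `|kappa z - w0|.
  move=> e0; apply: filterS2 GH (ck _ (diff_eps_near dH e0)) => z Gz.
  by rewrite Gz GHz0.
have absorb (a b : C) : a <= b + 2%:R^-1 * a -> a <= 2%:R * b.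
  move=> ab; rewrite -subr_ge0.
  have -> : 2%:R * b - a = 2%:R * (b + 2%:R^-1 * a - a) by field.
  by rewrite mulr_ge0// subr_ge0.
have small : \forall z \near z0, `|kappa z - w0| <= c * `|z - z0|.
  apply: filterS2 (nH _ e10) (diff_eps_near dG ltr01) => z.
  set k := kappa z - w0; set y := z - z0 => h1 h2.
  have kE : k = (G z - G z0) *m P - (G z - G z0 - 'd H w0 k) *m P.
    by rewrite -mulmxBl opprB addrC subrK HP.
  have i1 : `|(G z - G z0 - 'd H w0 k) *m P| <= 2%:R^-1 * `|k|.
    apply: le_trans (bP _) _; apply: le_trans (ler_wpM2l (ltW KP0) h1) _.
    by rewrite mulrA /e1 invfM mulrCA mulfV ?gt_eqF// mulr1.
  have i2 : `|G z - G z0| <= (D + 1) * `|y|.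
    rewrite -[G z - G z0](subrK ('d G z0 y)) addrC mulrDl.
    by apply: le_trans (ler_normD _ _) _; exact: lerD (bD _) h2.
  have i3 : `|k| <= KP * ((D + 1) * `|y|) + 2%:R^-1 * `|k|.
    rewrite {1}kE; apply: le_trans (ler_normB _ _) _; apply: lerD => //.
    by apply: le_trans (bP _) _; apply: ler_wpM2l => //; exact: ltW.
  by have := absorb _ _ i3; rewrite /c !mulrA.
have QG : Q ('d G z0 u) = 0.
  apply/normr0_eq0; apply: (@le_eps_eq0 _ (KQ * (1 + c) * `|u|)) => // [|e e0].
    by apply: mulr_ge0 => //; apply: mulr_ge0; [exact: ltW|exact: addr_ge0].
  have near_z : \forall z \near z0,
      `|Q ('d G z0 (z - z0))| <= e * (KQ * (1 + c)) * `|z - z0|.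
    apply: filterS3 (nH _ e0) (diff_eps_near dG e0) small => z.
    set k := kappa z - w0; set y := z - z0 => h1 h2 h3.
    have -> : Q ('d G z0 y) = Q (G z - G z0 - 'd H w0 k) - Q (G z - G z0 - 'd G z0 y).
      by rewrite !QB QH subr0 subKr.
    apply: le_trans (ler_normB _ _) _.
    apply: le_trans (lerD (bQ _) (bQ _)) _.
    rewrite -mulrDr [e * _]mulrCA -mulrA; apply: ler_wpM2l; first exact: ltW.
    apply: le_trans (lerD h1 h2) _.
    rewrite -mulrDr -mulrA; apply: ler_wpM2l; first exact: ltW.
    by rewrite mulrDl mul1r addrC lerD2l.
  have ct : (fun t : C => z0 + t *: u) @ (0 : C) --> z0.
    have ct : {for (0 : C), continuous (fun t : C => z0 + t *: u)}.
      have d1 : differentiable (id : C -> C) (0 : C) by [].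
      apply: differentiable_continuous; apply: differentiableD.
        exact: differentiable_cst.
      exact: (differentiableZl u d1).
    by move: ct; rewrite /prop_for /continuous_at scale0r addr0.
  have nt : \forall t \near (0 : C),
      `|Q ('d G z0 (t *: u))| <= e * (KQ * (1 + c)) * `|t *: u|.
    near=> t; rewrite -[t *: u](addKr z0) addrC.
    by near: t; exact: (ct _ near_z).
  have {}nt : \forall t \near (0 : C)^',
      `|Q ('d G z0 (t *: u))| <= e * (KQ * (1 + c)) * `|t *: u|.
    by move: nt; exact: cvg_within.
  have [t [t0]] := filter_ex (filterI (nbhs_dnbhs_neq (0 : C)) nt).
  have tn : 0 < `|t| by rewrite normr_gt0.
  have Q0 : Q 0 = 0 by rewrite /Q mul0mx linear0 subr0.
  have -> : Q ('d G z0 (t *: u)) = t *: Q ('d G z0 u).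
    by rewrite -[RHS]addr0 -Q0 -lQ addr0; congr (Q _); exact: linearZ.
  by rewrite !normrZ mulrCA ler_pM2l // !mulrA.
by exists ('d G z0 u *m P); apply/eqP; rewrite -subr_eq0 -/(Q _) QG.
Unshelve. all: by end_near. Qed.

End Tangents.

(** * Maps into submanifolds, etale maps and cotangent fibres *)

Section Submanifolds.
Variable R : realType.
Local Notation C := (Cx R).

Lemma embedding_holo m n (M : cmanifold R m) (N : cmanifold R n) (f : M -> N) x :
  embedding f -> holo_map_at f x.
Proof. by case=> hf _ _ _; exact: holo_map_all. Qed.

(** As an embedding is a homeomorphism onto its image, the factorisation of [phi]
    through [r] is continuous, which is the hypothesis of [differential_factor]. *)
Lemma tangent_in_submanifold p m n (F : cmanifold R p) (L : cmanifold R m)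
    (Z : cmanifold R n) (phi : F -> Z) (r : L -> Z) c a c' x l :
  holo_map_at phi x -> embedding r -> (forall y, range r (phi y)) ->
  atlas c -> atlas a -> atlas c' -> cdom c x -> cdom a l -> r l = phi x ->
  cdom c' (phi x) ->
  forall u, exists w, dmap c c' phi x u = dmap a c' r l w.
Proof.
move=> hphi er rphi ac aa ac' cx al rl c'x u.
have [_ injr immr topr] := er; have [_ hr] := embedding_holo l er.
pose lam y := projT1 (cid2 (rphi y)).
have lamE y : r (lam y) = phi y by rewrite /lam; case: (cid2 _).
have lamx : lam x = l by apply: injr; rewrite lamE.
have clam : {for x, continuous lam}.
  move=> W; rewrite lamx nbhsE => -[A [oA Al] AW].
  have [A' [oA' AE]] := topr A oA.
  have A'x : \forall z \near phi x, A' z.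
    by apply: open_nbhs_nbhs; split=> //; rewrite -rl; move: Al; rewrite AE.
  have [cphi _] := hphi.
  suff : \forall y \near x, W (lam y) by [].
  have A'phi : \forall y \near x, A' (phi y) by exact: (cphi _ A'x).
  apply: filterS A'phi => y A'y.
  by apply: AW; rewrite AE /= lamE.
pose kappa z := cfun a (lam (cinv c z)); pose z0 := cfun c x.
have k0 : kappa z0 = cfun a l by rewrite /kappa cfunK// lamx.
have ck : {for z0, continuous kappa}.
  apply: (@continuous_comp _ _ _ (cinv c) (fun y => cfun a (lam y))).
    exact/cinv_cont/dom_cimg.
  rewrite /z0 cfunK//; apply: (@continuous_comp _ _ _ lam (cfun a)).
    exact: clam.
  by rewrite lamx; exact: cfun_cont.
have c'l : cdom c' (r l) by rewrite rl.
have dG : differentiable (local_map c c' phi) z0.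
  by apply: holo_at_diff; case: hphi => _; exact.
have dH : differentiable (local_map a c' r) (kappa z0).
  by rewrite k0; apply: holo_at_diff; exact: hr.
have GH : \forall z \near z0, local_map c c' phi z = local_map a c' r (kappa z).
  have al' : \forall y \near lam x, cdom a y by rewrite lamx; exact: near_cdom.
  apply: filterS (near_cinv cx (clam _ al')) => z /= az.
  by rewrite /local_map /kappa cfunK// lamE.
have injH : injective ('d (local_map a c' r) (kappa z0)).
  have immrl := immr l a c' aa ac' al c'l.
  move=> v w vw; apply: immrl; rewrite /dmap -k0.
  by rewrite (deriveE v dH) (deriveE w dH).
have [w Ew] := differential_factor dG dH ck GH injH u.
exists w; rewrite /dmap -/z0 -k0.
by rewrite (deriveE u dG) (deriveE w dH).
Qed.

(** Tangent vectors are carried to tangent vectors of the submanifold, on which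
    [Om] vanishes. *)
Lemma pull2_isotropic p m n (F : cmanifold R p) (L : cmanifold R m)
    (Z : cmanifold R n) (phi : F -> Z) (r : L -> Z) (Om : form2 Z) :
  (forall x, holo_map_at phi x) -> embedding r -> (forall y, range r (phi y)) ->
  eq2 setT (pull2 r Om) (zero2 L) -> eq2 setT (pull2 phi Om) (zero2 F).
Proof.
move=> hphi er rphi iso c x u v ac cx _.
have [l _ rl] := rphi x.
have [al dl] := chart_atP l; have [az dz] := chart_atP (phi x).
have T := tangent_in_submanifold (hphi x) er rphi ac al az cx dl rl dz.
have [w1 E1] := T u; have [w2 E2] := T v.
have := iso (chart_at l) l w1 w2 al dl I.
rewrite /pull2 rl => H.
exact: (etrans (congr2 (Om (chart_at (phi x)) (phi x)) E1 E2) H).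
Qed.

Section EtaleMaps.
Variables (n : nat) (M N : cmanifold R n) (phi : M -> N).
Hypothesis ephi : etale phi.
Variables (c : chart R M n) (c' : chart R N n) (x : M).
Hypotheses (ac : atlas c) (ac' : atlas c') (cx : cdom c x) (c'x : cdom c' (phi x)).

(** The chain rule for [phi] and its local inverse, in both orders. *)
Lemma etale_inverse : exists psi : 'rV[C]_n -> 'rV[C]_n,
  cancel (dmap c c' phi x) psi /\ cancel psi (dmap c c' phi x).
Proof.
case: ephi => hphi /(_ x) [U [V [g [oU Ux oV UV [gK hg]]]]].
have Vx : V (phi x) by rewrite -UV; exists x.
have gx : g (phi x) = x by exact: gK.
have hphix := holo_map_all hphi x.
have hgx := holo_map_on_at oV hg Vx.
have cgx : cdom c (g (phi x)) by rewrite gx.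
have hphigx : holo_map_at phi (g (phi x)) by rewrite gx.
have cgx' : cdom c' (phi (g (phi x))) by rewrite gx.
exists (dmap c' c g (phi x)); split=> v.
  etransitivity; first exact: esym (dmap_comp hphix hgx v ac ac' ac cx c'x cgx).
  have near_id : \forall y \near x, (g \o phi) y = idfun y.
    by apply: filterS (near_open oU Ux) => y; exact: gK.
  exact: (etrans (dmap_near c v cx near_id) (dmap_id v cx)).
have := dmap_comp hgx hphigx v ac' ac ac' c'x cgx cgx'; rewrite gx => E.
have near_id : \forall y \near phi x, (phi \o g) y = idfun y.
  by apply: filterS (near_open oV Vx) => y; rewrite -UV => -[y' Uy' <-] /=; rewrite gK.
exact: (etrans (esym E) (etrans (dmap_near c' v c'x near_id) (dmap_id v c'x))).
Qed.

End EtaleMaps.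

Lemma pull1_add_sub m n (M : cmanifold R m) (N : cmanifold R n) (f : M -> N)
    (a1 a2 a3 : form1 N) c x v :
  pull1 f (sub1 (add1 a1 a2) a3) c x v =
  pull1 f a1 c x v + pull1 f a2 c x v - pull1 f a3 c x v.
Proof. by []. Qed.

Section Functoriality.
Variables (m n p : nat).
Variables (M : cmanifold R m) (N : cmanifold R n) (P : cmanifold R p).
Variables (f : M -> N) (g : N -> P).

Lemma pull1_comp (a : form1 P) c x v :
  holo_map_at f x -> holo_map_at g (f x) -> atlas c -> cdom c x ->
  pull1 f (pull1 g a) c x v = pull1 (g \o f) a c x v.
Proof.
move=> hf hg ac cx; have [an dn] := chart_atP (f x).
have [ap dp] := chart_atP (g (f x)).
exact: (congr1 _ (esym (dmap_comp hf hg v ac an ap cx dn dp))).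
Qed.

Lemma pull2_comp (a : form2 P) c x u v :
  holo_map_at f x -> holo_map_at g (f x) -> atlas c -> cdom c x ->
  pull2 f (pull2 g a) c x u v = pull2 (g \o f) a c x u v.
Proof.
move=> hf hg ac cx; have [an dn] := chart_atP (f x).
have [ap dp] := chart_atP (g (f x)).
have E w := esym (dmap_comp hf hg w ac an ap cx dn dp).
exact: (congr2 _ (E u) (E v)).
Qed.

End Functoriality.

Section Functions.
Variables (m n : nat) (M : cmanifold R m) (N : cmanifold R n) (k : M -> N).
Variables (V : set N) (g : N -> C) (c : chart R M m) (x : M).
Hypotheses (hg : holo_fun_on V g) (Vx : V (k x)).
Hypotheses (hk : holo_map_at k x) (ac : atlas c) (cx : cdom c x).

Let c' := chart_at (k x).

Let dk : differentiable (local_map c c' k) (cfun c x).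
Proof.
have [a' d'] := chart_atP (k x); apply: holo_at_diff.
by case: hk => _; exact.
Qed.

Let kx : local_map c c' k (cfun c x) = cfun c' (k x).
Proof. by rewrite /local_map cfunK. Qed.

Let dg : differentiable (fun z => g (cinv c' z)) (local_map c c' k (cfun c x)).
Proof.
have [a' d'] := chart_atP (k x).
by rewrite kx; apply: (cdiffn_diff (hg a' 0%N)); exists (k x).
Qed.

Let local_fun : \forall z \near cfun c x, (g \o k) (cinv c z) =
    ((fun z => g (cinv c' z)) \o local_map c c' k) z.
Proof.
have [a' d'] := chart_atP (k x); have [ck _] := hk.
apply: filterS (near_cinv cx (ck _ (near_cdom d'))) => z dz.
by rewrite /local_map /= cfunK.
Qed.

Lemma diff_fun_comp : differentiable (fun z => (g \o k) (cinv c z)) (cfun c x).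
Proof.
apply: differentiable_near; last exact: differentiable_comp dk dg.
by apply: filterS local_fun => z /esym.
Qed.

Lemma dlog_comp v : dlog (g \o k) c x v = pull1 k (dlog g) c x v.
Proof.
have D := etrans (near_eq_derive v local_fun) (derive_comp v dk dg).
rewrite kx in D; exact: (congr1 (fun p => (g (k x))^-1 * p) D).
Qed.

End Functions.

Section CotangentFibre.
Variables (d p : nat) (B : cmanifold R d) (T : cmanifold R (d + d)).
Variables (proj : T -> B) (base : chart R T (d + d) -> chart R B d).
Hypothesis cb : cotangent_bundle proj base.
Variables (F : cmanifold R p) (psi : F -> T) (b : B).
Hypotheses (hpsi : forall x, holo_map_at psi x) (psib : forall x, proj (psi x) = b).

(** The base coordinates are constant along a map into one fibre of the cotangent
    bundle. *)
Lemma dfst_fibre c c' x v q : atlas c -> atlas c' -> cdom c x -> cdom c' (psi x) ->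
  dfst q (dmap c c' psi x v) = 0.
Proof.
move=> ac ac' cx c'x; have [cpsi hh] := hpsi x.
have dpsi : differentiable (local_map c c' psi) (cfun c x).
  by apply: holo_at_diff; exact: hh.
have dl := linear_differentiable (local_map c c' psi (cfun c x))
  (linear_rV_continuous (@lsubmx_lin R d d)).
have D := derive_comp v dpsi dl.
rewrite (derive_lin (@lsubmx_lin R d d)) in D.
have E : \forall z \near cfun c x,
    (lsubmx \o local_map c c' psi) z = cst (cfun (base c') b) z.
  apply: filterS (near_cinv cx (cpsi _ (near_cdom c'x))) => z dz /=.
  by rewrite /local_map (cb_proj cb ac' dz) psib.
have D0 := etrans (near_eq_derive v E) (derive_cst _ _ _).
by rewrite /dfst /dmap -[local_map _ _ _]/(fun _ => _) in D *; rewrite -D D0 mxE.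
Qed.

Lemma liouville_fibre : forall c x v, atlas c -> cdom c x ->
  pull1 psi (@liouville R d T) c x v = 0.
Proof.
move=> c x v ac cx; have [a' d'] := chart_atP (psi x).
by rewrite /pull1 /liouville big1// => q _; rewrite dfst_fibre// mulr0.
Qed.

Lemma canonical_symplectic_fibre : forall c x u v, atlas c -> cdom c x ->
  pull2 psi (@canonical_symplectic R d T) c x u v = 0.
Proof.
move=> c x u v ac cx; have [a' d'] := chart_atP (psi x).
rewrite /pull2 /canonical_symplectic big1// => q _.
have wedge0 (a e : 'rV[C]_(d + d) -> C) w1 w2 : a w1 = 0 -> a w2 = 0 ->
  wedge a e w1 w2 = 0 by rewrite /wedge => -> ->; rewrite !mul0r subr0.
exact: (wedge0 _ _ _ _ (dfst_fibre u q ac a' cx d') (dfst_fibre v q ac a' cx d')).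
Qed.

End CotangentFibre.
End Submanifolds.

Theorem mainTheorem3 (R : realType) (d : nat)
  (M : cmanifold R (d + d)) (J : joyce_structure M)
  (actM : Cx R -> M -> M) (actX : Cx R -> jX J -> jX J)
  (hhom : homogeneous J actM actX)
  (CB : cotangent_structure J)
  (hlambda : eq1 setT (lie1 (euler_M M) (lambda CB))
                      (scale1 2%:R (lambda CB)))
  (Z1 : cmanifold R (d + d)) (q1 : jX J -> Z1) (hZ1 : twistor_fibre J 1 Z1 q1)
  (Omega1 : form2 Z1) (hOmega1 : symplectic Omega1)
  (hq1 : eq2 setT (pull2 q1 Omega1) (Omega_eps J 1))
  (Zoo : cmanifold R (d + d)) (qoo : jX J -> Zoo) (hZoo : twistor_fibre J 0 Zoo qoo)
  (Omegaoo : form2 Zoo) (hOmegaoo : symplectic Omegaoo)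
  (hqoo : eq2 setT (pull2 qoo Omegaoo) (Omega_minus J))
  (actZ : Cx R -> Zoo -> Zoo) (hactZ : Cstar_action actZ)
  (hqact : forall (a : Cx R) x, a != 0 -> qoo (actX a x) = actZ a (qoo x))
  (L : cmanifold R d) (r : L -> Zoo) (hr : embedding r)
  (hLag : eq2 setT (pull2 r Omegaoo) (zero2 L))
  (hinv : forall (a : Cx R) z, a != 0 -> range r z -> range r (actZ a z))
  (Y : cmanifold R (d + (d + d))) (i : Y -> jX J)
  (hY : submanifold i (qoo @^-1` range r))
  (f : Y -> cB CB) (hf : f = rho CB \o jpi J \o i)
  (hstar : forall (b : cB CB) (F : cmanifold R (d + d)) (k : F -> Y),
     submanifold k (f @^-1` [set b]) -> etale (q1 \o i \o k))
  (U1 : set Z1) (Theta1 : form1 Z1) (hTheta1 : potential U1 Theta1 Omega1)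
  (V : set Y) (tau : Y -> Cx R)
  (htau : tau_function J Z1 q1 Y i (Theta0L CB) U1 Theta1 V tau)
  (b : cB CB) (F : cmanifold R (d + d)) (k : F -> Y)
  (hF : submanifold k (f @^-1` [set b])) :
  let j := i \o k in
  eq1 (k @^-1` V) (dlog (tau \o k))
      (sub1 (pull1 j (twoi_Theta_I J)) (pull1 j (pull1 q1 Theta1))) /\
  (* every local branch K of log (tau|_F) is a generating function *)
  (forall (W : set F) (K : F -> Cx R),
     open W -> W `<=` k @^-1` V -> holo_fun_on W K ->
     (forall p, W p -> cexp (K p) = tau (k p)) ->
     generating_function (q1 \o j) (pull2 j (twoi_Omega_I J)) Omega1
       W (pull1 j (twoi_Theta_I J)) U1 Theta1 K).
Proof.
move=> j.
have tb := jX_tangent J.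
have [emb_i rng_i] := hY; have [emb_k rng_k] := hF.
have hk x : holo_map_at k x by exact: embedding_holo.
have hi x : holo_map_at i x by exact: embedding_holo.
have hj x : holo_map_at j x by apply: holo_map_comp.
have hpi x : holo_map_at (jpi J) x by exact: proj_holo tb x.
have hemb x : holo_map_at (cemb CB) x.
  by case: (cemb_open CB) => e _; exact: embedding_holo.
have hq x : holo_map_at q1 x by case: hZ1 => h _ _ _; exact: holo_map_all.
have hqo x : holo_map_at qoo x by case: hZoo => h _ _ _; exact: holo_map_all.
have hpij x : holo_map_at (jpi J \o j) x by exact: holo_map_comp.
pose psi := cemb CB \o (jpi J \o j).
have hpsi x : holo_map_at psi x by exact: holo_map_comp.
have hqj x : holo_map_at (q1 \o j) x by exact: holo_map_comp.
have hqoj x : holo_map_at (qoo \o j) x by exact: holo_map_comp.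
have et : etale (q1 \o j) := hstar b F k hF.
have psib y : @cproj _ _ _ _ CB (psi y) = b.
  have : (f @^-1` [set b]) (k y) by rewrite -rng_k; exists y.
  by rewrite /= hf.
have Theta0_fibre c x v : atlas c -> cdom c x ->
    pull1 j (pull1 (jpi J) (Theta0L CB)) c x v = 0.
  move=> ac cx; apply: (etrans (pull1_comp (Theta0L CB) v (hj x) (hpi (j x)) ac cx)).
  have E := pull1_comp (@liouville R d (cT CB)) v (hpij x) (hemb _) ac cx.
  have L0 := liouville_fibre (cT_cotangent CB) hpsi psib v ac cx.
  exact: (etrans (congr1 ( *%R (-1)) (etrans E L0)) (mulr0 _)).
have plus_fibre c x u v : atlas c -> cdom c x -> pull2 j (Omega_plus J) c x u v = 0.
  move=> ac cx.
  have E1 := eq2_pull2 (f := j) (pull2_jpi_Omega0 (J := J)) u v ac cx I.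
  have E2 := pull2_comp (Omega0 J) u v (hj x) (hpi (j x)) ac cx.
  have E3 := eq2_pull2 (f := jpi J \o j) (cemb_symplectic CB) u v ac cx I.
  have E4 := pull2_comp (@canonical_symplectic R d (cT CB)) u v (hpij x) (hemb _) ac cx.
  have E5 := canonical_symplectic_fibre (cT_cotangent CB) hpsi psib u v ac cx.
  exact: (etrans (esym E1) (etrans E2 (etrans E3 (etrans E4 E5)))).
have minus_fibre c x u v : atlas c -> cdom c x -> pull2 j (Omega_minus J) c x u v = 0.
  move=> ac cx.
  have rj y : range r ((qoo \o j) y).
    have : range i (i (k y)) by exists (k y).
    by rewrite rng_i.
  have E1 := eq2_pull2 (f := j) hqoo u v ac cx I.
  have E2 := pull2_comp Omegaoo u v (hj x) (hqo (j x)) ac cx.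
  have E3 := pull2_isotropic hqoj hr rj hLag u v ac cx I.
  exact: (etrans (esym E1) (etrans E2 E3)).
have symplectic_map : eq2 setT (pull2 (q1 \o j) Omega1) (pull2 j (twoi_Omega_I J)).
  move=> c x u v ac cx _.
  have E1 := pull2_comp Omega1 u v (hj x) (hq (j x)) ac cx.
  have E2 := eq2_pull2 (f := j) hq1 u v ac cx I.
  have E3 : pull2 j (Omega_eps J 1) c x u v = 1 ^+ 2 * pull2 j (Omega_plus J) c x u v +
      (2%:R * 'i * 1 * pull2 j (Omega_I J) c x u v + pull2 j (Omega_minus J) c x u v) by [].
  have P0 := plus_fibre c x u v ac cx; have M0 := minus_fibre c x u v ac cx.
  apply: (etrans (esym E1) (etrans E2 (etrans E3 _))).
  by rewrite P0 M0 mulr0 add0r addr0 mulr1.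
have Thform : is_form1 setT (pull1 j (twoi_Theta_I J)).
  exact: (pull1_form1 hj openT (twoi_Theta_I_form1 J)).
have dTh : eq2 setT (d1 (pull1 j (twoi_Theta_I J))) (pull2 j (twoi_Omega_I J)).
  move=> c x u v ac cx _.
  apply: (etrans (d1_pull1 hj openT (twoi_Theta_I_form1 J) u v ac cx I)).
  exact: (eq2_pull2 (f := j) (d1_twoi_Theta_I (J := J)) u v ac cx I).
have symplF : symplectic (pull2 j (twoi_Omega_I J)).
  split.
  - exact: (is_form2_eq openT dTh (d1_form2 openT Thform)).
  - exact: (closed2_eq openT dTh (d1_closed openT Thform)).
  - move=> c x u ac cx u0; have [a' d'] := chart_atP (q1 (j x)).
    have [s [sK Ks]] := etale_inverse et ac a' cx d'.
    have [_ _ nondeg] := hOmega1.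
    have du0 : dmap c (chart_at (q1 (j x))) (q1 \o j) x u = 0.
      apply: (nondeg _ _ _ a' d') => w; rewrite -[w]Ks.
      exact: (etrans (symplectic_map c x u (s w) ac cx I) (u0 _)).
    by rewrite -[u]sK du0 -[RHS]sK /dmap derive0.
have dlogF : eq1 (k @^-1` V) (dlog (tau \o k))
    (sub1 (pull1 j (twoi_Theta_I J)) (pull1 j (pull1 q1 Theta1))).
  case: htau => _ _ htauV _ dlt c x v ac cx Vx.
  have [a' d'] := chart_atP (k x).
  apply: (etrans (dlog_comp htauV Vx (hk x) ac cx v)).
  apply: (etrans (dlt _ _ _ a' d' Vx)).
  have C1 a := pull1_comp a v (hk x) (hi (k x)) ac cx.
  have C2 := etrans (C1 (pull1 (jpi J) (Theta0L CB))) (Theta0_fibre c x v ac cx).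
  have E := congr2 (fun p q => p - q) (congr2 +%R C2 (C1 (twoi_Theta_I J)))
    (C1 (pull1 q1 Theta1)).
  have E0 := pull1_add_sub i (pull1 (jpi J) (Theta0L CB)) (twoi_Theta_I J)
    (pull1 q1 Theta1) (chart_at (k x)) (k x) (dmap c (chart_at (k x)) k x v).
  apply: (etrans E0); apply: (etrans E).
  exact: (congr1 (fun p => p - _) (add0r _)).
split; first exact: dlogF.
move=> W K oW WV hK expK.
have [_ sV htauV tau0 _] := htau.
split.
- split; [exact: symplF|exact: hOmega1].
- split; [by case: et|exact: symplectic_map].
- split; last exact: hTheta1.
  split; [exact: oW|exact: (is_form1S openT (@subsetT _ W) oW Thform)|].
  by move=> c x u v ac cx _; exact: dTh.
- by move=> x /WV /sV.
- split; first exact: hK.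
  move=> c x v ac cx Wx.
  have Vx := WV _ Wx.
  have E1 := dlogF c x v ac cx Vx.
  have E2 := pull1_comp Theta1 v (hj x) (hq (j x)) ac cx.
  have dK : differentiable (fun z => K (cinv c z)) (cfun c x).
    exact: (cdiffn_diff (hK c ac 0%N) (imageP _ (conj cx Wx))).
  have nW : \forall z \near cfun c x, cexp (K (cinv c z)) = (tau \o k) (cinv c z).
    by apply: filterS (near_cinv cx (near_open oW Wx)) => z Wz; exact: expK.
  have dtau := diff_fun_comp htauV Vx (hk x) ac cx.
  have D := derive_cexp v nW dK dtau.
  have {}D : d0 (tau \o k) c x v = tau (k x) * d0 K c x v.
    exact: (etrans D (congr1 (fun y => tau (k y) * d0 K c x v) (cfunK cx))).
  have E3 : dlog (tau \o k) c x v = d0 K c x v.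
    exact: (etrans (congr1 ( *%R (tau (k x))^-1) D) (mulKf (tau0 _ Vx) _)).
  apply: (etrans (esym E3)); apply: (etrans E1).
  exact: (congr1 (fun p => pull1 j (twoi_Theta_I J) c x v - p) E2).
Qed.
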